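(* Consider the finite-horizon MDP with the conditional value-at-risk $\mathcal R^\pi$ at level $\alpha\in(0,1)$ and the empirical risks described in the context. There is a universal constant $C>0$ such that the following holds for any $\epsilon>0$ and $\delta\in(0,1)$, where inside the logarithms each of the quantities $L_\pi$, $1/\epsilon$ is read as the maximum of itself and $2$. (i) Let $\pi$ be a randomized Markovian policy of the augmented MDP with $\|\pi_t(\cdot|s,x)-\pi_t(\cdot|s,x')\|_1\le L_\pi|x-x'|$ for all $0\le t\le T$, $s\in\mathcal S_t$, $x,x'\in\mathcal X_t$, for some $L_\pi>0$. If $$n=\left\lceil C\,\frac{T^2}{\alpha^2\epsilon^2}\log\left(\frac{T|\mathcal S|L_\pi}{\delta\alpha\epsilon}\right)\right\rceil,$$ then with probability at least $1-\delta$, $|\hat{\mathcal R}^\pi_n(s)-\mathcal R^\pi(s)|\le\epsilon$ for all $s\in\mathcal S_0$. (ii) If $$n=\left\lceil C\,\frac{T^3}{\alpha^2\epsilon^2}\log\left(\frac{T|\mathcal S||\mathcal A|}{\delta\alpha\epsilon}\right)\right\rceil,$$ then with probability at least $1-\delta$, $|\hat{\mathcal R}^*_n(s)-\mathcal R^*(s)|\le\epsilon$ for all $s\in\mathcal S_0$.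
   Context: MDP: $T$ is a positive integer; for $0\le t\le T$, $\mathcal S_t$ is a finite state space, $\mathcal A_t$ a finite action space, $c_t:\mathcal S_t\times\mathcal A_t\to[0,1]$ a cost; for $0\le t\le T-1$, $\mathbb P_t(\cdot|s,a)$ is a probability distribution on $\mathcal S_{t+1}$. $|\mathcal S|=\max_t|\mathcal S_t|$, $|\mathcal A|=\max_t|\mathcal A_t|$. $\Pi(\mathcal M)$ is the set of randomized history-dependent policies (mapping $H_t=(S_0,A_0,\dots,S_t)$ to distributions on $\mathcal A_t$). Augmented state: $\mathcal X_t=[0,t]$, $X_0=0$, $X_{t+1}=X_t+c_t(S_t,A_t)$; a randomized Markovian policy of the augmented MDP takes $A_t\sim\pi_t(\cdot|S_t,X_t)$. Risk: $\mathcal R^\pi(s)=\min_{\mu\in\mathbb R}\{\mu+\frac1\alpha\mathbb E^\pi_{\mathbb P}[(\sum_{t=0}^Tc_t(S_t,A_t)-\mu)_+\mid S_0=s]\}$, where $(y)_+=\max\{y,0\}$; $\mathcal R^*(s)=\min_{\pi\in\Pi(\mathcal M)}\mathcal R^\pi(s)$. Sampling: for every $t$ and $(s,a)$ one draws $n$ i.i.d. samples from $\mathbb P_t(\cdot|s,a)$ (independently over $(t,s,a)$), giving empirical kernels $\hat{\mathbb P}_{t,n}$. $\hat{\mathcal R}^\pi_n$ is $\mathcal R^\pi$ with $\mathbb P_t$ replaced by $\hat{\mathbb P}_{t,n}$; $\hat{\mathcal R}^*_n(s)=\min_{\pi\in\Pi(\mathcal M)}\hat{\mathcal R}^\pi_n(s)$.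 In (i), $\pi$ does not depend on the samples. *)

(* Defs.v *)
From HB Require Import structures.
From mathcomp Require Import all_boot all_order all_algebra.
From mathcomp Require Import all_classical all_reals all_analysis.

Set Implicit Arguments.
Unset Strict Implicit.
Unset Printing Implicit Defensive.

Import Order.TTheory GRing.Theory Num.Theory.
Import numFieldNormedType.Exports.

Local Open Scope classical_set_scope.
Local Open Scope ring_scope.

Definition is_pmf (R : realType) (X : finType) (p : X -> R) : Prop :=
  (forall x, 0 <= p x) /\ \sum_(x : X) p x = 1.

(* The decision epochs are 0, ..., T.  All families are indexed by nat; the
   state and action spaces and the costs at t > T, and the transitions at
   t >= T, are unconstrained and never used. *)
Record mdp (R : realType) (T : nat) := Mdp {
  state : nat -> finType;
  action : nat -> finType;
  cost : forall t, state t -> action t -> R;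
  trans : forall t, state t -> action t -> state t.+1 -> R;
  action_gt0 : forall t, (t <= T)%N -> (0 < #|action t|)%N;
  cost_itv : forall t (s : state t) (a : action t),
    (t <= T)%N -> 0 <= cost s a <= 1;
  trans_pmf : forall t (s : state t) (a : action t),
    (t < T)%N -> is_pmf (trans s a)
}.

Arguments state {R T} M t : rename.
Arguments action {R T} M t : rename.
Arguments cost {R T} M {t} s a : rename.
Arguments trans {R T} M {t} s a s' : rename.

Section Risk.
Variables (R : realType) (T : nat) (M : mdp R T).

Definition max_states : nat := \max_(t < T.+1) #|state M t|.
Definition max_actions : nat := \max_(t < T.+1) #|action M t|.

(* A kernel need not be the one of M: empirical kernels also have this type. *)
Definition trans_kernel := forall t, state M t -> action M t -> state M t.+1 -> R.

(* Histories (S_0, A_0, ..., A_(t-1), S_t). *)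
Fixpoint hist (t : nat) : finType :=
  if t is u.+1 then (hist u * action M u * state M u.+1)%type
  else state M 0.

Definition last_state (t : nat) : hist t -> state M t :=
  match t with
  | 0 => fun h => h
  | _.+1 => fun h => h.2
  end.

(* The augmented coordinate: X_0 = 0 and X_(t+1) = X_t + c_t(S_t, A_t). *)
Fixpoint hist_cost (t : nat) : hist t -> R :=
  match t with
  | 0 => fun _ => 0
  | _.+1 => fun h => hist_cost h.1.1 + cost M (last_state h.1.1) h.1.2
  end.

(* Randomized history-dependent policies. *)
Definition policy := forall t, hist t -> action M t -> R.

Definition is_policy : set policy :=
  [set pi | forall t (h : hist t), (t <= T)%N -> is_pmf (pi t h)].

(* Randomized Markovian policies of the augmented MDP; the second argument is
   relevant only on the interval [0, t]. *)
Definition aug_policy := forall t, state M t -> R -> action M t -> R.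

Definition is_aug_policy (pi : aug_policy) : Prop :=
  forall t (s : state M t) (x : R),
    (t <= T)%N -> 0 <= x <= t%:R -> is_pmf (pi t s x).

Definition aug_lipschitz (L : R) (pi : aug_policy) : Prop :=
  forall t (s : state M t) (x x' : R),
    (t <= T)%N -> 0 <= x <= t%:R -> 0 <= x' <= t%:R ->
    \sum_(a : action M t) `|pi t s x a - pi t s x' a| <= L * `|x - x'|.

Definition policy_of_aug (pi : aug_policy) : policy :=
  fun t h => pi t (last_state h) (hist_cost h).

(* Law of the history H_t when S_0 = s. *)
Fixpoint hist_prob (P : trans_kernel) (pi : policy) (s : state M 0) (t : nat) :
    hist t -> R :=
  match t with
  | 0 => fun h => (h == s)%:R
  | u.+1 => fun h =>
      hist_prob P pi s h.1.1 * pi u h.1.1 h.1.2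
      * P u (last_state h.1.1) h.1.2 h.2
  end.

Definition expect (P : trans_kernel) (pi : policy) (s : state M 0)
    (f : hist T -> action M T -> R) : R :=
  \sum_(h : hist T) \sum_(a : action M T) hist_prob P pi s h * pi T h a * f h a.

Definition total_cost (h : hist T) (a : action M T) : R :=
  hist_cost h + cost M (last_state h) a.

(* The infima below are the minima of the mathematical definitions: they are
   attained as soon as P t is a transition kernel for every t < T. *)
Definition risk (alpha : R) (P : trans_kernel) (pi : policy) (s : state M 0) : R :=
  inf [set mu + alpha^-1 *
             expect P pi s (fun h a => Num.max (total_cost h a - mu) 0)
      | mu in [set: R]].

Definition opt_risk (alpha : R) (P : trans_kernel) (s : state M 0) : R :=
  inf [set risk alpha P pi s | pi in is_policy].

End Risk.

Section Sampling.
Variables (R : realType) (d : measure_display) (Omega : measurableType d).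
Variable (Pr : probability Omega R).

(* Mutual independence of a finite family of random variables with values in
   finite (discrete) spaces. *)
Definition mutually_independent (I : finType) (V : I -> finType)
    (X : forall i, Omega -> V i) : Prop :=
  forall (J : {set I}) (B : forall i, set (V i)),
    (Pr (\bigcap_(i in [set` J]) (X i @^-1` B i)) =
     \prod_(i in J) Pr (X i @^-1` B i))%E.

Variables (T : nat) (M : mdp R T) (n : nat).

(* Y t s a i is the i-th sample drawn from trans s a at epoch t. *)
Definition sampler :=
  forall t, state M t -> action M t -> 'I_n -> Omega -> state M t.+1.

Definition sample_index : finType :=
  {t : 'I_T & (state M t * action M t * 'I_n)%type}.

Definition is_generative_sampler (Y : sampler) : Prop :=
  [/\ (forall t (s : state M t) (a : action M t) (i : 'I_n) (s' : state M t.+1),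
         (t < T)%N -> measurable (Y t s a i @^-1` [set s'])),
      (forall t (s : state M t) (a : action M t) (i : 'I_n) (s' : state M t.+1),
         (t < T)%N -> Pr (Y t s a i @^-1` [set s']) = (trans M s a s')%:E) &
      mutually_independent
        (fun k : sample_index =>
           Y (tag k) (tagged k).1.1 (tagged k).1.2 (tagged k).2)].

Definition empirical_kernel (Y : sampler) (w : Omega) : trans_kernel M :=
  fun t s a s' => #|[set i : 'I_n | Y t s a i w == s']%SET|%:R / n%:R.

End Sampling.

(* Main.v *)
Require Import Defs.
From HB Require Import structures.
From mathcomp Require Import all_boot all_order all_algebra.
From mathcomp Require Import all_classical all_reals all_analysis.
From mathcomp Require Import ring lra.

Set Implicit Arguments.
Unset Strict Implicit.
Unset Printing Implicit Defensive.

Import Order.TTheory GRing.Theory Num.Theory.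
Import numFieldNormedType.Exports.

Local Open Scope classical_set_scope.
Local Open Scope ring_scope.

(** The empirical value [Vhat] of the augmented MDP with terminal cost
    [(z - mu)_+] and its true value [V] are compared through the tilted moment
    [E exp (lam (Vhat - V) + beta Vhat^2)] with [beta = 8 lam^2 / n].  One
    transition averages [n] fresh samples of the next empirical value; Jensen's
    inequality absorbs the mean of that value, and the quadratic term absorbs
    its conditional variance, so that, as in the law of total variance, no
    factor [T] accumulates.  By backward induction the moment is at most
    [exp (beta (T+1)^2)] for a fixed policy and [|A|^T exp (beta (T+1)^2)] for
    the optimal value, the factor [|A|^T] coming from bounding the minimum over
    actions by a sum at each step.  Chernoff's bound and a union bound over the
    initial states and a grid of values of [mu] conclude. *)

(** The quadratic term is taken in [Vhat], not in [V], because the fresh samples of an epoch see the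
    variance of the next empirical value [f] under the true kernel. Its mean [m] and variance [v]
    contribute [beta m^2 + beta v], which is exactly [beta E f^2]: the exponent is again a mean of
    exponents of the same form, and convexity moves the true average outside. Bounding each epoch
    separately by the range of the values would cost about [lam^2 B^2 / n] per epoch, with
    [B = T + 1], hence a cubic power of [T] already for a fixed policy. The moment is bounded at
    each fixed history or augmented state, never uniformly over them: the next value is a function
    untouched by resampling the current epoch, so the accumulated cost is never discretised. For the
    optimal value, the Chernoff exponent must also beat [T log |A|], the origin of [T^3]. *)

Section FiniteMean.

(** * Means, variances and exponential moments on a finite set *)

Context {R : realType}.

Lemma mean_ge0 (X : finType) (p f : X -> R) :
  is_pmf p -> (forall x, 0 <= f x) -> 0 <= \sum_x p x * f x.
Proof. by move=> [p0 _] f0; apply: sumr_ge0 => x _; rewrite mulr_ge0. Qed.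

Lemma mean_le (X : finType) (p f g : X -> R) :
  is_pmf p -> (forall x, f x <= g x) -> \sum_x p x * f x <= \sum_x p x * g x.
Proof. by move=> [p0 _] fg; apply: ler_sum => x _; rewrite ler_wpM2l. Qed.

Lemma mean_cst (X : finType) (p : X -> R) (c : R) :
  is_pmf p -> \sum_x p x * c = c.
Proof. by move=> [_ p1]; rewrite -mulr_suml p1 mul1r. Qed.

Lemma mean_itv (X : finType) (p f : X -> R) (B : R) :
  is_pmf p -> (forall x, 0 <= f x <= B) -> 0 <= \sum_x p x * f x <= B.
Proof.
move=> pp fB; apply/andP; split.
  by apply: mean_ge0 => // x; case/andP: (fB x).
by rewrite -[leRHS](mean_cst B pp); apply: mean_le => // x; case/andP: (fB x).
Qed.

Lemma mean_center (X : finType) (p f : X -> R) :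
  is_pmf p -> \sum_x p x * (f x - \sum_y p y * f y) = 0.
Proof.
move=> pp; under eq_bigr do rewrite mulrBr.
by rewrite sumrB mean_cst // subrr.
Qed.

Lemma variance_mean (X : finType) (p f : X -> R) : is_pmf p ->
  \sum_x p x * (f x - \sum_y p y * f y) ^+ 2 =
  \sum_x p x * f x ^+ 2 - (\sum_x p x * f x) ^+ 2.
Proof.
move=> pp; set m := \sum_y p y * f y.
under eq_bigr => x _.
  have -> : p x * (f x - m) ^+ 2 = p x * f x ^+ 2 - (2 * m) * (p x * f x) + p x * m ^+ 2.
    by ring.
  over.
by rewrite big_split /= sumrB -mulr_sumr mean_cst // -/m; ring.
Qed.

Lemma sqr_mean_le (X : finType) (p f : X -> R) : is_pmf p ->
  (\sum_x p x * f x) ^+ 2 <= \sum_x p x * f x ^+ 2.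
Proof.
move=> pp; rewrite -subr_ge0 -variance_mean //.
by apply: mean_ge0 => // x; rewrite sqr_ge0.
Qed.

Lemma expR_mean_le (X : finType) (p z : X -> R) : is_pmf p ->
  expR (\sum_x p x * z x) <= \sum_x p x * expR (z x).
Proof.
move=> pp; set m := \sum_x _.
have -> : expR m = \sum_x p x * (expR m * (1 + (z x - m))).
  under eq_bigr do rewrite mulrDr mulr1 mulrDr mulrCA.
  by rewrite big_split /= mean_cst // -mulr_sumr mean_center // mulr0 addr0.
apply: mean_le => // x.
have -> : expR (z x) = expR m * expR (z x - m) by rewrite -expRD addrC subrK.
by rewrite ler_wpM2l ?expR_ge0 // expR_ge1Dx.
Qed.

(** Squaring [exp h <= 1 / (1 - h)] at [h = z / 2] reduces the claim to
    [h^2 (1 - 6 h + 4 h^2) >= 0], which holds for [h <= 1/8]. *)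
Lemma expR_le_quadratic (z : R) : z <= 4^-1 -> expR z <= 1 + z + z ^+ 2.
Proof.
move=> z4; set h := z / 2.
have h1 : 0 < 1 - h by rewrite /h; lra.
have eh : expR h <= (1 - h)^-1.
  rewrite -[expR h]invrK -expRN lef_pV2 ?posrE ?expR_gt0 //.
  by apply: le_trans (expR_ge1Dx _); rewrite addrC.
have -> : expR z = expR h ^+ 2 by rewrite expr2 -expRD /h -splitr.
apply: (@le_trans _ _ ((1 - h)^-1 ^+ 2)).
  by rewrite ler_sqr ?nnegrE ?expR_ge0 // invr_ge0 ltW.
rewrite exprVn -[leLHS]mul1r ler_pdivrMr ?exprn_gt0 //.
have -> : z = 2 * h by rewrite /h mulrC divfK.
rewrite -subr_ge0.
have -> : (1 + 2 * h + (2 * h) ^+ 2) * (1 - h) ^+ 2 - 1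
          = h ^+ 2 * (1 - 6 * h + 4 * h ^+ 2) by ring.
rewrite mulr_ge0 ?sqr_ge0 //.
have : h <= 8^-1 by rewrite /h; lra.
have := sqr_ge0 h; lra.
Qed.

(* One more sample in an empirical mean: the quadratic part of the exponent is
   large enough to pay for the increase of the conditional variance. *)
Lemma expR_quadratic_sample (X : finType) (p f : X -> R) (n : nat)
    (B lam beta v m : R) :
  is_pmf p -> (forall x, 0 <= f x <= B) -> (8 <= n)%N ->
  24 * `|lam| * B <= n%:R -> `|v| <= 2 * B -> beta = 8 * lam ^+ 2 / n%:R ->
  m = \sum_x p x * f x ->
  \sum_x p x * expR (lam * (v + (f x - m) / n%:R)
                     + beta * (v + (f x - m) / n%:R) ^+ 2)
  <= expR (lam * v + beta * v ^+ 2
           + beta * (\sum_x p x * (f x - m) ^+ 2) / n%:R).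
Proof.
move=> pp fB n8 lamB vB -> mE.
have n0 : 0 < n%:R :> R by rewrite ltr0n (leq_trans _ n8).
set r := n%:R^-1; have r0 : 0 < r by rewrite invr_gt0.
have r8 : r <= 8^-1 by rewrite lef_pV2 ?posrE // ler_nat.
set V := \sum_x p x * (f x - m) ^+ 2.
have /andP[m0 mB] : 0 <= m <= B by rewrite mE; exact: mean_itv.
set l := lam * r.
have lB : `|l| * B <= 24^-1.
  rewrite /l normrM (gtr0_norm r0) mulrAC ler_pdivrMr //.
  by move: lamB; set x := `|lam|; lra.
have V0 : 0 <= V by apply: mean_ge0 => // x; rewrite sqr_ge0.
(* With [l = lam / n], the increment of the exponent is [l * (f x - m)] times a factor bounded by
   5/2 in absolute value. *)
have e1 x : lam * (v + (f x - m) * r)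
    + 8 * lam ^+ 2 * r * (v + (f x - m) * r) ^+ 2
  = lam * v + 8 * lam ^+ 2 * r * v ^+ 2
    + l * (f x - m) * (1 + 16 * (l * v) + 8 * r * (l * (f x - m))).
  by rewrite /l; ring.
under eq_bigr => x _ do rewrite e1 expRD mulrCA.
rewrite -mulr_sumr [leRHS]expRD ler_wpM2l ?expR_ge0 //.
have -> : 8 * lam ^+ 2 * r * V * r = 8 * l ^+ 2 * V by rewrite /l; ring.
apply: le_trans (expR_ge1Dx _).
have lv : `|l * v| <= 12^-1.
  rewrite normrM; apply: (@le_trans _ _ (`|l| * (2 * B))).
    by rewrite ler_wpM2l.
  by move: lB; set y := `|l|; lra.
(* The square of that factor is at most 25/4, and [8 r <= 1] adds at most 1: the total stays below
   8, the coefficient in [beta]. The part linear in [f x - m] is kept apart because its mean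
   vanishes. *)
have key x : expR (l * (f x - m) * (1 + 16 * (l * v) + 8 * r * (l * (f x - m))))
   <= 1 + l * (1 + 16 * (l * v)) * (f x - m) + 8 * l ^+ 2 * (f x - m) ^+ 2.
  have lx : `|l * (f x - m)| <= 24^-1.
    rewrite normrM; apply: (le_trans _ lB); rewrite ler_wpM2l //.
    by rewrite ler_norml; have := fB x; lra.
  have -> : l * (1 + 16 * (l * v)) * (f x - m) =
            (1 + 16 * (l * v)) * (l * (f x - m)) by ring.
  have -> : 8 * l ^+ 2 * (f x - m) ^+ 2 = 8 * (l * (f x - m)) ^+ 2 by ring.
  move: lx lv; set z := l * (f x - m); set y := l * v.
  rewrite !ler_norml => /andP[z1 z2] /andP[y1 y2].
  set s := 1 + 16 * y + 8 * r * z.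
  have rz1 : 8 * r * z <= 24^-1 by nra.
  have rz2 : - 24^-1 <= 8 * r * z by nra.
  have sB : `|s| <= 5 / 2 by rewrite ler_norml /s; lra.
  have s2 : s ^+ 2 <= 25 / 4.
    by rewrite -real_normK ?num_real // (_ : 25 / 4 = (5 / 2) ^+ 2);
      [rewrite ler_sqr ?nnegrE|field].
  have zs : z * s <= 4^-1.
    apply: le_trans (ler_norm _) _; rewrite normrM.
    have z3 : `|z| <= 24^-1 by rewrite ler_norml z1 z2.
    by apply: le_trans (ler_pM _ _ z3 sB) _ => //; lra.
  apply: le_trans (expR_le_quadratic zs) _.
  rewrite exprMn.
  have := sqr_ge0 z; set z' := z ^+ 2 => z'0.
  have -> : z * s = (1 + 16 * y) * z + 8 * r * z' by rewrite /s /z'; ring.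
  have : z' * s ^+ 2 <= z' * (25 / 4) by rewrite ler_wpM2l.
  have : 8 * r * z' <= z' by rewrite ler_piMl //; lra.
  by lra.
apply: le_trans (mean_le pp key) _.
under eq_bigr => x _.
  have -> : p x * (1 + l * (1 + 16 * (l * v)) * (f x - m)
                     + 8 * l ^+ 2 * (f x - m) ^+ 2)
          = p x * 1 + l * (1 + 16 * (l * v)) * (p x * (f x - m))
            + 8 * l ^+ 2 * (p x * (f x - m) ^+ 2) by ring.
  over.
have cm : \sum_x p x * (f x - m) = 0 by rewrite mE mean_center.
by rewrite !big_split /= -2!mulr_sumr mean_cst // cm mulr0 addr0.
Qed.

End FiniteMean.

(** * Product weights on a finite table and resampling of one coordinate *)

Section ProductSpace.
Context {R : realType} {I : finType} {V : I -> finType}.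
Variable p : forall i, V i -> R.

Local Notation W := {dffun forall i, V i}.

Definition product_weight (w : W) : R := \prod_i p (w i).

Definition update (w : W) (i : I) (v : V i) : W :=
  finfun (dfwith (fun j => w j) i v).

Lemma update_in (w : W) (i : I) (v : V i) : update w v i = v.
Proof. by rewrite ffunE dfwithin. Qed.

Lemma update_out (w : W) (i j : I) (v : V i) : i != j -> update w v j = w j.
Proof. by move=> ij; rewrite ffunE dfwithout. Qed.

Lemma update_update (w : W) (i : I) (v v' : V i) :
  update (update w v) v' = update w v'.
Proof.
apply/ffunP => j; have [->|ij] := eqVneq j i; first by rewrite !update_in.
by rewrite !update_out // eq_sym.
Qed.

Lemma update_id (w : W) (i : I) : update w (w i) = w.
Proof.
apply/ffunP => j; have [->|ij] := eqVneq j i; first by rewrite !update_in.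
by rewrite update_out // eq_sym.
Qed.

(** The cross-multiplied form avoids a ratio whose denominator [p (w i)] may vanish. *)
Lemma product_weight_update (w : W) (i : I) (v : V i) :
  product_weight w * p v = product_weight (update w v) * p (w i).
Proof.
rewrite /product_weight (bigD1 i) //= [in RHS](bigD1 i) //= update_in.
under [in RHS]eq_bigr => j ji do rewrite update_out 1?eq_sym //.
by ring.
Qed.

Hypothesis p_pmf : forall i, is_pmf (@p i).

Lemma product_weight_ge0 (w : W) : 0 <= product_weight w.
Proof. by apply: prodr_ge0 => i _; case: (p_pmf i). Qed.

(* The involution [(w, v) |-> (update w v, w i)] preserves the weight of the
   pair. *)
Lemma resample (i : I) (G : W -> V i -> R) :
  (forall w (v v' : V i), G (update w v) v' = G w v') ->
  \sum_w product_weight w * G w (w i) =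
  \sum_w product_weight w * (\sum_v p v * G w v).
Proof.
move=> Gi; pose h (x : W * V i) := (update x.1 x.2, x.1 i).
have hK : involutive h.
  by case=> w v; rewrite /h /= update_in update_update update_id.
transitivity (\sum_(x : W * V i) product_weight x.1 * (p x.2 * G x.1 (x.1 i))).
  rewrite -(pair_bigA _ (fun w v => product_weight w * (p v * G w (w i)))) /=.
  apply: eq_bigr => w _; rewrite -mulr_sumr -mulr_suml.
  by have [_ ->] := p_pmf i; rewrite mul1r.
under [RHS]eq_bigr do rewrite mulr_sumr.
rewrite pair_bigA /= [RHS](reindex_inj (inv_inj hK)) /=.
apply: eq_bigr => x _.
by rewrite Gi mulrA mulrA -product_weight_update mulrAC.
Qed.

End ProductSpace.

(** * Exponential moment of an empirical mean *)

Section EmpiricalMean.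
Context {R : realType} {I : finType} {V : I -> finType}.
Variable p : forall i, V i -> R.
Hypothesis p_pmf : forall i, is_pmf (@p i).

Local Notation W := {dffun forall i, V i}.

(* The samples are the coordinates [kappa i] of the product space; [read] only
   serves to identify their types with the common space [X]. *)
Variables (n : nat) (X : finType) (P : X -> R).
Variables (kappa : 'I_n -> I) (read : forall i, V (kappa i) -> X).
Hypothesis kappa_inj : injective kappa.
Hypothesis P_pmf : is_pmf P.
Hypothesis read_law : forall i (F : X -> R),
  \sum_v p v * F (@read i v) = \sum_x P x * F x.

Variables (f : W -> X -> R) (B lam beta : R).
Hypothesis f_itv : forall w x, 0 <= f w x <= B.
Hypothesis f_update : forall w i (v : V (kappa i)), f (update w v) = f w.
Hypothesis n_ge8 : (8 <= n)%N.
Hypothesis lam_le : 24 * `|lam| * B <= n%:R.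
Hypothesis betaE : beta = 8 * lam ^+ 2 / n%:R.

Let m (w : W) : R := \sum_x P x * f w x.
Let var (w : W) : R := \sum_x P x * (f w x - m w) ^+ 2.
(** The conditional mean of the empirical mean once the first [j] samples are known: a martingale
    running from [m] to the empirical mean. *)
Let A (j : nat) (w : W) : R :=
  m w + \sum_(i < n | (i < j)%N) (f w (read (w (kappa i))) - m w) / n%:R.
(** Each of the [n - j] samples not yet revealed is charged [beta * var / n] in advance, the price
    of one application of [expR_quadratic_sample]. *)
Let S (j : nat) : R := \sum_w product_weight p w *
  expR (lam * A j w + beta * A j w ^+ 2 + (n - j)%:R * (beta * var w / n%:R)).

Let n_gt0 : 0 < n%:R :> R.
Proof. by rewrite ltr0n (leq_trans _ n_ge8). Qed.

Let m_itv w : 0 <= m w <= B.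
Proof. exact: mean_itv. Qed.

Let A_le j w : `|A j w| <= 2 * B.
Proof.
have B0 : 0 <= B by have := m_itv w; lra.
have mB : `|m w| <= B by rewrite ler_norml; have := m_itv w; lra.
apply: (le_trans (ler_normD _ _)).
suff : `|\sum_(i < n | (i < j)%N) (f w (read (w (kappa i))) - m w) / n%:R| <= B.
  by move: mB; lra.
apply: (le_trans (ler_norm_sum _ _ _)).
apply: (@le_trans _ _ (\sum_(i < n) B / n%:R)).
  rewrite big_mkcond; apply: ler_sum => i _; case: ifP => _.
    rewrite normrM (gtr0_norm (_ : 0 < n%:R^-1)) ?invr_gt0 //.
    rewrite ler_wpM2r ?invr_ge0 ?ler0n // ler_norml.
    by have := m_itv w; have := f_itv w (read (w (kappa i))); lra.
  by rewrite divr_ge0 // ltW.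
by rewrite sumr_const card_ord -(mulr_natr (_ / _)) divfK // gt_eqF.
Qed.

(** Sample [j] is integrated out and its charge consumed: [m] and [var] do not see it by [f_update],
    nor does [A j], by injectivity of [kappa]. *)
Let S_anti j : (j < n)%N -> S j.+1 <= S j.
Proof.
move=> jn; pose i0 := Ordinal jn.
have AS w : A j.+1 w = A j w + (f w (read (w (kappa i0))) - m w) / n%:R.
  rewrite /A (bigD1 i0) //= -addrA; congr (_ + _); rewrite addrC.
  congr (_ + _); apply: eq_bigl => i.
  by rewrite ltnS [RHS]ltn_neqAle -val_eqE /= andbC.
have mU w (v : V (kappa i0)) : m (update w v) = m w by rewrite /m f_update.
have vU w (v : V (kappa i0)) : var (update w v) = var w.
  by rewrite /var f_update mU.
have AU w (v : V (kappa i0)) : A j (update w v) = A j w.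
  rewrite /A mU f_update; congr (_ + _); apply: eq_bigr => i ij.
  rewrite update_out // eq_sym; apply: contraTneq ij => /kappa_inj ->.
  by rewrite ltnn.
pose G w (v : V (kappa i0)) : R :=
  expR (lam * (A j w + (f w (read v) - m w) / n%:R)
        + beta * (A j w + (f w (read v) - m w) / n%:R) ^+ 2
        + (n - j.+1)%:R * (beta * var w / n%:R)).
rewrite /S.
under eq_bigr do rewrite AS.
rewrite (resample p_pmf (i := kappa i0) (G := G)); last first.
  by move=> w v v'; rewrite /G AU f_update mU vU.
apply: ler_sum => w _; rewrite ler_wpM2l ?product_weight_ge0 //.
rewrite /G.
under eq_bigr do rewrite expRD mulrA.
rewrite -mulr_suml (read_law i0 (fun x =>
  expR (lam * (A j w + (f w x - m w) / n%:R)
        + beta * (A j w + (f w x - m w) / n%:R) ^+ 2))).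
have -> : (n - j)%:R * (beta * var w / n%:R) =
    beta * var w / n%:R + (n - j.+1)%:R * (beta * var w / n%:R).
  by rewrite -(subnSK jn) -natr1 mulrDl mul1r addrC.
rewrite [X in _ <= expR X]addrA [leRHS]expRD ler_wpM2r ?expR_ge0 //.
exact: expR_quadratic_sample.
Qed.

(** The left side is [S n]. In [S 0] the full charge [beta * var] joins [beta * m^2] to form [beta]
    times the mean of [f^2], so that the exponent becomes a mean. *)
Lemma empirical_mean_exp_moment (mhat : W -> R) :
  (forall w, mhat w = (\sum_i f w (read (w (kappa i)))) / n%:R) ->
  \sum_w product_weight p w * expR (lam * mhat w + beta * mhat w ^+ 2) <=
  \sum_w product_weight p w *
    expR (\sum_x P x * (lam * f w x + beta * f w x ^+ 2)).
Proof.
move=> mhatE.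
have -> : \sum_w product_weight p w * expR (lam * mhat w + beta * mhat w ^+ 2)
    = S n.
  apply: eq_bigr => w _; rewrite subnn mul0r addr0.
  suff -> : A n w = mhat w by [].
  rewrite mhatE /A; under eq_bigl do rewrite ltn_ord.
  rewrite -mulr_suml sumrB sumr_const card_ord -(mulr_natr (m w)) mulrBl.
  by rewrite mulfK ?gt_eqF // addrC subrK.
have -> : \sum_w product_weight p w *
    expR (\sum_x P x * (lam * f w x + beta * f w x ^+ 2)) = S 0.
  apply: eq_bigr => w _; congr (_ * expR _).
  have -> : A 0 w = m w by rewrite /A big_pred0 // addr0.
  rewrite subn0 [n%:R * _]mulrC divfK ?gt_eqF //.
  rewrite [in RHS]/var variance_mean // -/(m w).
  under eq_bigr do rewrite mulrDr [_ * (lam * _)]mulrCA [_ * (beta * _)]mulrCA.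
  by rewrite big_split /= -!mulr_sumr -/(m w); ring.
suff SS j : (j <= n)%N -> S j <= S 0 by exact: SS.
elim: j => // j IH jn.
by apply: (le_trans (S_anti jn)); apply: IH; exact: ltnW.
Qed.

End EmpiricalMean.

(** * Minima over finite action sets *)

Section FiniteMin.
Context {R : realType} {A : finType}.

(** An option, because action sets beyond the horizon may be empty while [greedy_policy] is defined
    at every epoch. *)
Definition fargmin (f : A -> R) : option A :=
  [pick a | [forall b, f a <= f b]].

(* [0] when [A] is empty. *)
Definition fmin (f : A -> R) : R :=
  if fargmin f is Some a then f a else 0.

Lemma fargminP (f : A -> R) : (0 < #|A|)%N ->
  exists a, [/\ fargmin f = Some a, fmin f = f a & forall b, f a <= f b].
Proof.
move=> /card_gt0P[a0 _]; rewrite /fmin /fargmin; case: pickP => [a /forallP fa|].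
  by exists a.
case: (arg_minP f (erefl : xpredT a0)) => a _ fa /(_ a) /negP[].
by apply/forallP => b; exact: fa.
Qed.

Lemma fmin_le (f : A -> R) (a : A) : fmin f <= f a.
Proof.
have [|b [_ -> //]] := fargminP f.
by apply/card_gt0P; exists a.
Qed.

Lemma fmin_leD (f g : A -> R) (c : R) : (0 < #|A|)%N ->
  (forall a, f a <= g a + c) -> fmin f <= fmin g + c.
Proof.
move=> A0 fg; have [a [_ -> _]] := fargminP g A0.
exact: le_trans (fmin_le f a) (fg a).
Qed.

Lemma eq_fmin (f g : A -> R) : f =1 g -> fmin f = fmin g.
Proof. by move=> /funext ->. Qed.

Lemma fmin_itv (f : A -> R) (B : R) : (0 < #|A|)%N ->
  (forall a, 0 <= f a <= B) -> 0 <= fmin f <= B.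
Proof. by move=> A0 fB; have [a [_ -> _]] := fargminP f A0. Qed.

End FiniteMin.

(** * Backward recursions for a fixed policy and for the optimum *)

Section Values.
Context {R : realType} {T : nat} (M : mdp R T).

Definition is_kernel (P : trans_kernel M) : Prop :=
  forall t (s : state M t) (a : action M t), (t < T)%N -> is_pmf (P t s a).

Lemma trans_is_kernel : is_kernel (@trans R T M).
Proof. by move=> t s a; exact: trans_pmf. Qed.

(* The number [k] of remaining transitions is a separate argument because a
   history of length [t + k] has no type convertible to [hist M T]. *)
Fixpoint policy_value (g : R -> R) (P : trans_kernel M) (pi : policy M)
    (k t : nat) (h : hist M t) : R :=
  match k with
  | 0 => \sum_a pi t h a * g (hist_cost h + cost M (last_state h) a)
  | l.+1 => \sum_a pi t h a * \sum_s' P t (last_state h) a s' *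
              policy_value g P pi l ((h, a, s') : hist M t.+1)
  end.

Fixpoint opt_value (g : R -> R) (P : trans_kernel M) (k t : nat)
    (s : state M t) (y : R) : R :=
  match k with
  | 0 => fmin (fun a => g (y + cost M s a))
  | l.+1 => fmin (fun a => \sum_s' P t s a s' *
              opt_value g P l s' (y + cost M s a))
  end.

Lemma policy_valueS (g : R -> R) (P : trans_kernel M) (pi : policy M)
    (k t : nat) (h : hist M t) :
  policy_value g P pi k.+1 h =
  \sum_a pi t h a * \sum_s' P t (last_state h) a s' *
    policy_value g P pi k ((h, a, s') : hist M t.+1).
Proof. by []. Qed.

Lemma opt_valueS (g : R -> R) (P : trans_kernel M) (k t : nat)
    (s : state M t) (y : R) :
  opt_value g P k.+1 s y =
  fmin (fun a => \sum_s' P t s a s' * opt_value g P k s' (y + cost M s a)).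
Proof. by []. Qed.

Lemma sum_hist t (F : hist M t.+1 -> R) :
  \sum_x F x = \sum_(h : hist M t) \sum_(a : action M t) \sum_(s' : state M t.+1)
    F (h, a, s').
Proof.
by rewrite !pair_bigA /=; apply: eq_bigr => -[[h a] s'] _.
Qed.

(** The mean of the value-to-go under the law of the history is the same at every epoch, since
    [hist_prob] gains exactly the factors that one unfolding of [policy_value] exposes. Epochs [0]
    and [T] give the two sides. *)
Lemma expect_policy_value (g : R -> R) (P : trans_kernel M) (pi : policy M)
    (s : state M 0) :
  expect P pi s (fun h a => g (total_cost h a)) =
  policy_value g P pi T (s : hist M 0).
Proof.
have step k t : \sum_(h : hist M t) hist_prob P pi s h * policy_value g P pi k.+1 h
    = \sum_(h : hist M t.+1) hist_prob P pi s h * policy_value g P pi k h.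
  rewrite sum_hist.
  apply: eq_bigr => h _; rewrite mulr_sumr; apply: eq_bigr => a _.
  by rewrite mulrA mulr_sumr; apply: eq_bigr => s' _; rewrite !mulrA.
have all t : (t <= T)%N ->
    \sum_(h : hist M t) hist_prob P pi s h * policy_value g P pi (T - t) h
    = policy_value g P pi T (s : hist M 0).
  elim: t => [_|t IH tT]; last by rewrite -step subnSK // IH // ltnW.
  rewrite subn0 (bigD1 (s : hist M 0)) //= eqxx mul1r big1 ?addr0 //.
  by move=> h /negPf /= ->; rewrite mul0r.
rewrite -(all T) // subnn /expect; apply: eq_bigr => h _ /=.
by rewrite mulr_sumr; apply: eq_bigr => a _; rewrite mulrA.
Qed.

Lemma hist_cost_itv t (h : hist M t) : (t <= T)%N -> 0 <= hist_cost h <= t%:R.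
Proof.
elim: t h => [|t IH] h tT; first by rewrite lexx.
rewrite /= -natr1; have := IH h.1.1 (ltnW tT).
have := cost_itv (last_state h.1.1) h.1.2 (ltnW tT).
by move=> /andP[c0 c1] /andP[y0 y1]; rewrite addr_ge0 // lerD.
Qed.

Lemma total_cost_itv (h : hist M T) (a : action M T) :
  0 <= total_cost h a <= T.+1%:R.
Proof.
rewrite /total_cost -natr1; have := hist_cost_itv h (leqnn T).
have := cost_itv (last_state h) a (leqnn T).
by move=> /andP[c0 c1] /andP[y0 y1]; rewrite addr_ge0 // lerD.
Qed.

(** The choices of [c] yield every clause of [excess_mean] except nonnegativity. *)
Lemma policy_value_leD (g g' : R -> R) (c : R) (P : trans_kernel M)
    (pi : policy M) (k t : nat) (h : hist M t) :
  is_kernel P -> is_policy pi -> (forall z, g z <= g' z + c) ->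
  (t + k = T)%N -> policy_value g P pi k h <= policy_value g' P pi k h + c.
Proof.
move=> PK piP gg; elim: k t h => [|k IH] t h tk /=.
  have pp : is_pmf (pi t h) by apply: piP; rewrite -tk leq_addr.
  rewrite -[X in _ <= _ + X](mean_cst c pp) -big_split /=.
  by under [leRHS]eq_bigr do rewrite -mulrDr; exact: mean_le.
have pp : is_pmf (pi t h) by apply: piP; rewrite -tk leq_addr.
rewrite -[X in _ <= _ + X](mean_cst c pp) -big_split /=.
under [leRHS]eq_bigr do rewrite -mulrDr; apply: mean_le => // a.
have Pp : is_pmf (P t (last_state h) a) by apply: PK; rewrite -tk -addn1 leq_add2l.
rewrite -[X in _ <= _ + X](mean_cst c Pp) -big_split /=.
under [leRHS]eq_bigr do rewrite -mulrDr; apply: mean_le => // s'.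
by apply: IH; rewrite addSnnS.
Qed.

Lemma policy_value_itv (g : R -> R) (B : R) (P : trans_kernel M)
    (pi : policy M) (k t : nat) (h : hist M t) :
  is_kernel P -> is_policy pi -> (forall z, 0 <= g z <= B) ->
  (t + k = T)%N -> 0 <= policy_value g P pi k h <= B.
Proof.
move=> PK piP gB; elim: k t h => [|k IH] t h tk /=.
  by apply: mean_itv => //; apply: piP; rewrite -tk leq_addr.
apply: mean_itv => [|a]; first by apply: piP; rewrite -tk leq_addr.
apply: mean_itv => [|s']; last by apply: IH; rewrite addSnnS.
by apply: PK; rewrite -tk -addn1 leq_add2l.
Qed.

(** Locality in time: the value from epoch [t] on does not react to samples of earlier epochs. This
    supplies the independence used in the moment induction. *)
Lemma eq_policy_value (g : R -> R) (P P' : trans_kernel M) (pi : policy M)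
    (k t : nat) (h : hist M t) :
  (forall u (s : state M u) a s', (t <= u < t + k)%N -> P u s a s' = P' u s a s') ->
  policy_value g P pi k h = policy_value g P' pi k h.
Proof.
elim: k t h => [|k IH] t h PP' //=.
apply: eq_bigr => a _; congr (_ * _); apply: eq_bigr => s' _.
rewrite PP' ?leqnn ?addnS ?ltnS ?leq_addr //; congr (_ * _); apply: IH => u s b r tu.
by apply: PP'; move: tu; rewrite addSnnS => /andP[/ltnW -> ->].
Qed.

Lemma opt_value_leD (g g' : R -> R) (c : R) (P : trans_kernel M)
    (k t : nat) (s : state M t) (y : R) :
  is_kernel P -> (forall z, g z <= g' z + c) ->
  (t + k = T)%N -> opt_value g P k s y <= opt_value g' P k s y + c.
Proof.
move=> PK gg; elim: k t s y => [|k IH] t s y tk /=.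
  by apply: fmin_leD => //; apply: action_gt0; rewrite -tk leq_addr.
apply: fmin_leD => [|a]; first by apply: action_gt0; rewrite -tk leq_addr.
have Pp : is_pmf (P t s a) by apply: PK; rewrite -tk -addn1 leq_add2l.
rewrite -[X in _ <= _ + X](mean_cst c Pp) -big_split /=.
under [leRHS]eq_bigr do rewrite -mulrDr; apply: mean_le => // s'.
by apply: IH; rewrite addSnnS.
Qed.

Lemma opt_value_itv (g : R -> R) (B : R) (P : trans_kernel M)
    (k t : nat) (s : state M t) (y : R) :
  is_kernel P -> (forall z, 0 <= g z <= B) ->
  (t + k = T)%N -> 0 <= opt_value g P k s y <= B.
Proof.
move=> PK gB; elim: k t s y => [|k IH] t s y tk /=.
  by apply: fmin_itv => //; apply: action_gt0; rewrite -tk leq_addr.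
apply: fmin_itv => [|a]; first by apply: action_gt0; rewrite -tk leq_addr.
apply: mean_itv => [|s']; last by apply: IH; rewrite addSnnS.
by apply: PK; rewrite -tk -addn1 leq_add2l.
Qed.

Lemma eq_opt_value (g : R -> R) (P P' : trans_kernel M)
    (k t : nat) (s : state M t) (y : R) :
  (forall u (s : state M u) a s', (t <= u < t + k)%N -> P u s a s' = P' u s a s') ->
  opt_value g P k s y = opt_value g P' k s y.
Proof.
elim: k t s y => [|k IH] t s y PP' //=.
apply: eq_fmin => a; apply: eq_bigr => s' _.
rewrite PP' ?leqnn ?addnS ?ltnS ?leq_addr //; congr (_ * _); apply: IH => u r b r' tu.
by apply: PP'; move: tu; rewrite addSnnS => /andP[/ltnW -> ->].
Qed.

(** A mean dominates a minimum at every epoch, so memory beyond the current state and the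
    accumulated cost gains nothing. *)
Lemma opt_value_le (g : R -> R) (P : trans_kernel M) (pi : policy M)
    (k t : nat) (h : hist M t) :
  is_kernel P -> is_policy pi -> (t + k = T)%N ->
  opt_value g P k (last_state h) (hist_cost h) <= policy_value g P pi k h.
Proof.
move=> PK piP; elim: k t h => [|k IH] t h tk /=.
  have pp : is_pmf (pi t h) by apply: piP; rewrite -tk leq_addr.
  rewrite -[leLHS](mean_cst _ pp); apply: mean_le => // a.
  exact: (fmin_le (fun a => g (hist_cost h + cost M (last_state h) a))).
have pp : is_pmf (pi t h) by apply: piP; rewrite -tk leq_addr.
rewrite -[leLHS](mean_cst _ pp); apply: mean_le => // a.
apply: (le_trans (fmin_le _ a)); apply: mean_le => [|s'].
  by apply: PK; rewrite -tk -addn1 leq_add2l.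
by apply: (IH t.+1 (h, a, s')); rewrite addSnnS.
Qed.

(** A policy knows the epoch but not the number of remaining transitions, which is recovered as
    [T - t]. Past the horizon the truncated difference selects the terminal branch, where
    [is_policy] asks nothing. *)
Definition greedy_policy (g : R -> R) (P : trans_kernel M) : policy M :=
  fun t h a =>
    (fargmin (if (T - t)%N is l.+1 then
                fun b => \sum_s' P t (last_state h) b s' *
                  opt_value g P l s' (hist_cost h + cost M (last_state h) b)
              else fun b => g (hist_cost h + cost M (last_state h) b))
     == Some a)%:R.

Lemma greedy_policyP (g : R -> R) (P : trans_kernel M) :
  is_policy (greedy_policy g P).
Proof.
move=> t h tT; split=> [a|]; first by rewrite /greedy_policy ler0n.
rewrite /greedy_policy.
set F := (X in fargmin X).
have [a [-> _ _]] := fargminP F (action_gt0 M tT).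
rewrite (bigD1 a) //= eqxx big1 ?addr0 // => b ba.
by case: eqP => // -[ab]; rewrite ab eqxx in ba.
Qed.

Lemma greedy_policy_value (g : R -> R) (P : trans_kernel M)
    (k t : nat) (h : hist M t) : (t + k = T)%N ->
  policy_value g P (greedy_policy g P) k h =
  opt_value g P k (last_state h) (hist_cost h).
Proof.
have pick1 (A : finType) (f F : A -> R) : (0 < #|A|)%N ->
    \sum_a (fargmin f == Some a)%:R * F a =
    if fargmin f is Some a then F a else 0.
  move=> A0; have [a [-> _ _]] := fargminP f A0.
  rewrite (bigD1 a) //= eqxx mul1r big1 ?addr0 // => b ba.
  by case: eqP => [[ab]|_]; [rewrite ab eqxx in ba|rewrite mul0r].
elim: k t h => [|k IH] t h tk.
  have tT : (t <= T)%N by rewrite -tk leq_addr.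
  have Tt : (T - t = 0)%N by rewrite -tk addKn.
  by rewrite /= /greedy_policy Tt pick1 ?action_gt0.
have tT : (t <= T)%N by rewrite -tk leq_addr.
have Tt : (T - t = k.+1)%N by rewrite -tk addKn.
rewrite /= {1}/greedy_policy Tt pick1 ?action_gt0 // /fmin.
case: fargmin => // a; apply: eq_bigr => s' _; congr (_ * _).
by rewrite (IH t.+1) // addSnnS.
Qed.

End Values.

(** * Exponential moments of the empirical values *)

Section Sampling.
Context {R : realType} {T : nat} (M : mdp R T) (n : nat).

Local Notation index := (sample_index M n).
Local Notation W := {dffun forall k : index, state M (tag k).+1}.

Definition sample_law (k : index) : state M (tag k).+1 -> R :=
  trans M (tagged k).1.1 (tagged k).1.2.

Lemma sample_law_pmf (k : index) : is_pmf (@sample_law k).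
Proof. exact: trans_pmf. Qed.

Local Notation weight := (product_weight sample_law).

Definition sample_at t (tT : (t < T)%N) (s : state M t) (a : action M t)
    (i : 'I_n) : index :=
  existT (fun u : 'I_T => (state M u * action M u * 'I_n)%type)
    (Ordinal tT) (s, a, i).

(* The empirical kernel as a function of the finite table of all samples; junk
   value [0] for [t >= T]. *)
Definition table_kernel (w : W) : trans_kernel M := fun t s a s' =>
  match pselect (t < T)%N with
  | left tT => #|[set i | w (sample_at tT s a i) == s']%SET|%:R / n%:R
  | right _ => 0
  end.

Lemma table_kernelE (w : W) t (tT : (t < T)%N) s a s' :
  table_kernel w s a s' =
  #|[set i | w (sample_at tT s a i) == s']%SET|%:R / n%:R.
Proof.
by rewrite /table_kernel; case: pselect => // tT'; rewrite (bool_irrelevance tT' tT).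
Qed.

Lemma mean_table_kernel (w : W) t (tT : (t < T)%N) s a (F : state M t.+1 -> R) :
  \sum_s' table_kernel w s a s' * F s' =
  (\sum_i F (w (sample_at tT s a i))) / n%:R.
Proof.
under eq_bigr => s' _.
  rewrite (table_kernelE w tT) mulrAC -sum1dep_card natr_sum.
  rewrite big_mkcond mulr_suml.
  over.
rewrite -mulr_suml exchange_big /=; congr (_ / _); apply: eq_bigr => i _.
rewrite (bigD1 (w (sample_at tT s a i))) //= eqxx mul1r big1 ?addr0 // => s'.
by rewrite eq_sym => /negPf ->; rewrite mul0r.
Qed.

Lemma table_kernel_is_kernel (w : W) : (0 < n)%N -> is_kernel (table_kernel w).
Proof.
move=> n0 t s a tT; split=> [s'|].
  by rewrite (table_kernelE w tT) divr_ge0.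
under eq_bigr do rewrite -[table_kernel _ _ _ _]mulr1.
rewrite (mean_table_kernel w tT s a (fun=> 1)) sumr_const card_ord divff //.
by rewrite pnatr_eq0 -lt0n.
Qed.

Lemma table_kernel_update (w : W) t (tT : (t < T)%N) s a i
    (v : state M (tag (sample_at tT s a i)).+1) u (r : state M u) b r' :
  t != u -> table_kernel (update w v) r b r' = table_kernel w r b r'.
Proof.
move=> tu; rewrite /table_kernel; case: pselect => // uT.
congr (_%:R / _); apply: eq_card => j; rewrite !inE update_out //.
by apply: contraNneq tu => /(congr1 (fun k : index => val (tag k))) /= ->.
Qed.

Variables (B lam beta : R).
Hypothesis n_ge8 : (8 <= n)%N.
Hypothesis lam_le : 24 * `|lam| * B <= n%:R.
Hypothesis betaE : beta = 8 * lam ^+ 2 / n%:R.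

Let beta_ge0 : 0 <= beta.
Proof. by rewrite betaE divr_ge0 // mulr_ge0 // sqr_ge0. Qed.

Definition tilt (xhat x : R) : R := expR (lam * (xhat - x) + beta * xhat ^+ 2).

(** Jensen for the exponential and, as [beta >= 0], for the square. Averaging over the actions of a
    policy, whose weights are not random, therefore costs nothing. *)
Lemma tilt_mean_le (X : finType) (p xhat x : X -> R) : is_pmf p ->
  tilt (\sum_a p a * xhat a) (\sum_a p a * x a) <=
  \sum_a p a * tilt (xhat a) (x a).
Proof.
move=> pp; apply: le_trans (expR_mean_le _ pp); rewrite ler_expR.
under [leRHS]eq_bigr do rewrite mulrDr mulrCA [_ * (beta * _)]mulrCA mulrBr.
rewrite big_split /= -!mulr_sumr sumrB lerD2l ler_wpM2l //.
exact: sqr_mean_le.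
Qed.

(** One action already dominates, but it may be the minimiser of [xhat], which will depend on the
    samples; the sum makes the bound uniform in them. *)
Lemma tilt_fmin_le (A : finType) (xhat x : A -> R) : (0 < #|A|)%N ->
  (forall a, 0 <= xhat a) ->
  tilt (fmin xhat) (fmin x) <= \sum_a tilt (xhat a) (x a).
Proof.
move=> A0 xhat0.
suff [a le_a] : exists a, tilt (fmin xhat) (fmin x) <= tilt (xhat a) (x a).
  rewrite (bigD1 a) //= (le_trans le_a) // lerDl sumr_ge0 // => b _.
  exact: expR_ge0.
have [a [_ ea _]] := fargminP x A0.
have [b [_ eb _]] := fargminP xhat A0.
(* For [lam >= 0] the minimiser of [x] works, both terms being monotone in [xhat >= 0]. For
   [lam < 0] that of [xhat] works: the quadratic term is unchanged and only [fmin x] is compared. *)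
have [l0|l0] := lerP 0 lam.
- exists a; rewrite ea ler_expR.
  have h0 : 0 <= fmin xhat by rewrite eb.
  have ha := fmin_le xhat a.
  apply: lerD; first by rewrite ler_wpM2l // lerD2r.
  by rewrite ler_wpM2l // ler_sqr // nnegrE.
- exists b; rewrite eb ler_expR lerD2r.
  by apply: ler_wnM2l; [exact: ltW|rewrite lerD2l lerN2 fmin_le].
Qed.

Lemma table_kernel_tilt_le t (tT : (t < T)%N) (s : state M t) (a : action M t)
    (f : W -> state M t.+1 -> R) (v : state M t.+1 -> R) :
  (forall w s', 0 <= f w s' <= B) ->
  (forall w i (x : state M (tag (sample_at tT s a i)).+1), f (update w x) = f w) ->
  \sum_w weight w * tilt (\sum_s' table_kernel w s a s' * f w s')
                         (\sum_s' trans M s a s' * v s') <=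
  \sum_s' trans M s a s' * \sum_w weight w * tilt (f w s') (v s').
Proof.
move=> fB fU.
have pp : is_pmf (trans M s a) by exact: trans_pmf.
set m := \sum_s' trans M s a s' * v s'.
have sample_inj : injective (sample_at tT s a).
  move=> i j /eqP; rewrite /sample_at -tag_eqE /tag_eq /= eqxx tagged_asE.
  by move=> /eqP[].
have key := empirical_mean_exp_moment sample_law_pmf
  (X := state M t.+1) (kappa := sample_at tT s a) (read := fun i x => x) sample_inj pp
  (fun i F => erefl) fB fU n_ge8 lam_le betaE
  (fun w => mean_table_kernel w tT s a (f w)).
(* The true mean [m] is not random and factors out; Jensen under the true kernel then splits the
   joint exponent over [s']. *)
apply: (@le_trans _ _ (expR (- (lam * m)) * \sum_w weight w *
    expR (\sum_s' trans M s a s' * (lam * f w s' + beta * f w s' ^+ 2)))).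
  apply: le_trans (ler_wpM2l (expR_ge0 _) key); rewrite mulr_sumr.
  apply: ler_sum => w _; rewrite mulrCA -expRD ler_wpM2l //.
    by apply: product_weight_ge0; exact: sample_law_pmf.
  by rewrite ler_expR mulrBr; lra.
under [leRHS]eq_bigr do rewrite mulr_sumr.
rewrite [leRHS]exchange_big /= mulr_sumr; apply: ler_sum => w _.
under [leRHS]eq_bigr do rewrite mulrCA.
rewrite -mulr_sumr mulrCA ler_wpM2l //.
  by apply: product_weight_ge0; exact: sample_law_pmf.
apply: le_trans (expR_mean_le _ pp); rewrite -expRD ler_expR.
have -> : - (lam * m) = \sum_s' trans M s a s' * (- lam * v s').
  by rewrite /m mulr_sumr -sumrN; apply: eq_bigr => s' _; ring.
rewrite -big_split /=; apply: ler_sum => s' _.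
by rewrite -mulrDr ler_wpM2l ?(proj1 pp) //; lra.
Qed.

Hypothesis weight_total : \sum_w weight w = 1.

Let weight_pmf : is_pmf weight.
Proof.
split=> // w; apply: product_weight_ge0; exact: sample_law_pmf.
Qed.

Let n_gt0 : (0 < n)%N.
Proof. exact: leq_trans n_ge8. Qed.

Variable g : R -> R.
Hypothesis g_itv : forall z, 0 <= g z <= B.

Let tilt_diag_le (x : R) : 0 <= x <= B -> tilt x x <= expR (beta * B ^+ 2).
Proof.
move=> /andP[x0 xB]; rewrite /tilt subrr mulr0 add0r ler_expR ler_wpM2l //.
by rewrite ler_sqr // nnegrE // (le_trans x0).
Qed.

(** At [k = 0] no sample is read, both values agree and only the quadratic term remains. Each
    earlier epoch only averages, so the bound propagates unchanged. *)
Lemma policy_value_exp_moment (pi : policy M) (k t : nat) (h : hist M t) :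
  is_policy pi -> (t + k = T)%N ->
  \sum_w weight w * tilt (policy_value g (table_kernel w) pi k h)
                         (policy_value g (@trans R T M) pi k h) <=
  expR (beta * B ^+ 2).
Proof.
move=> piP; elim: k t h => [|k IH] t h tk.
  rewrite -[leRHS](mean_cst _ weight_pmf); apply: mean_le => // w.
  by apply: tilt_diag_le; apply: policy_value_itv => //; exact: table_kernel_is_kernel.
have tT : (t < T)%N by rewrite -tk -addn1 leq_add2l.
have pp : is_pmf (pi t h) by apply: piP; exact: ltnW.
have Pp a : is_pmf (trans M (last_state h) a) by exact: trans_pmf.
have fB a w (s' : state M t.+1) :
    0 <= policy_value g (table_kernel w) pi k ((h, a, s') : hist M t.+1) <= B.
  by apply: policy_value_itv => //; [exact: table_kernel_is_kernel|rewrite addSnnS].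
have fU a (w : W) i (x : state M (tag (sample_at tT (last_state h) a i)).+1) :
    (fun s' => policy_value g (table_kernel (update w x)) pi k
                 ((h, a, s') : hist M t.+1)) =
    (fun s' => policy_value g (table_kernel w) pi k ((h, a, s') : hist M t.+1)).
  apply/funext => s'; apply: eq_policy_value => u r b r' /andP[tu _].
  by apply: table_kernel_update; rewrite neq_ltn tu.
under eq_bigr do rewrite 2!policy_valueS.
apply: le_trans (mean_le weight_pmf (fun w => tilt_mean_le _ _ pp)) _.
under eq_bigr do rewrite mulr_sumr.
rewrite exchange_big /= -[leRHS](mean_cst _ pp); apply: ler_sum => a _.
under eq_bigr do rewrite mulrCA.
rewrite -mulr_sumr ler_wpM2l ?(proj1 pp) //.
apply: le_trans (table_kernel_tilt_le _ (fB a) (fU a)) _.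
rewrite -[leRHS](mean_cst _ (Pp a)); apply: mean_le => // s'.
by apply: IH; rewrite addSnnS.
Qed.

(** The terminal minimum reads no sample and is free, so the power counts the [k] transitions rather
    than the [k + 1] minima. *)
Lemma opt_value_exp_moment (k t : nat) (s : state M t) (y : R) :
  (t + k = T)%N ->
  \sum_w weight w * tilt (opt_value g (table_kernel w) k s y)
                         (opt_value g (@trans R T M) k s y) <=
  (max_actions M)%:R ^+ k * expR (beta * B ^+ 2).
Proof.
elim: k t s y => [|k IH] t s y tk.
  rewrite expr0 mul1r -[leRHS](mean_cst _ weight_pmf); apply: mean_le => // w.
  by apply: tilt_diag_le; apply: opt_value_itv => //; exact: table_kernel_is_kernel.
have tT : (t < T)%N by rewrite -tk -addn1 leq_add2l.
have A0 : (0 < #|action M t|)%N by apply: action_gt0; exact: ltnW.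
have Pp a : is_pmf (trans M s a) by exact: trans_pmf.
have TK w : is_kernel (table_kernel w) by exact: table_kernel_is_kernel.
have fB a w s' :
    0 <= opt_value g (table_kernel w) k (s' : state M t.+1) (y + cost M s a) <= B.
  by apply: opt_value_itv => //; rewrite addSnnS.
have fU a (w : W) i (x : state M (tag (sample_at tT s a i)).+1) :
    (fun s' : state M t.+1 =>
       opt_value g (table_kernel (update w x)) k s' (y + cost M s a)) =
    (fun s' => opt_value g (table_kernel w) k s' (y + cost M s a)).
  apply/funext => s'; apply: eq_opt_value => u r b r' /andP[tu _].
  by apply: table_kernel_update; rewrite neq_ltn tu.
have mean0 w a : 0 <= \sum_s' table_kernel w s a s' *
    opt_value g (table_kernel w) k s' (y + cost M s a).
  by apply: mean_ge0 => [|s']; [exact: TK|case/andP: (fB a w s')].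
under eq_bigr do rewrite 2!opt_valueS.
apply: le_trans (mean_le weight_pmf (fun w => tilt_fmin_le _ A0 (mean0 w))) _.
under eq_bigr do rewrite mulr_sumr.
rewrite exchange_big /=.
have AM : #|action M t|%:R <= (max_actions M)%:R :> R.
  rewrite ler_nat /max_actions.
  exact: (leq_bigmax (F := fun i : 'I_T.+1 => #|action M i|)
    (Ordinal (leq_trans tT (leqnSn T)))).
rewrite exprS -mulrA.
apply: le_trans (ler_wpM2r _ AM); last by rewrite mulr_ge0 ?exprn_ge0 ?expR_ge0.
rewrite mulrC mulr_natr -sumr_const; apply: ler_sum => a _.
apply: le_trans (table_kernel_tilt_le _ (fB a) (fU a)) _.
rewrite -[leRHS](mean_cst _ (Pp a)); apply: mean_le => // s'.
by apply: IH; rewrite addSnnS.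
Qed.

End Sampling.

(** * Chernoff's bound *)

Section Tail.
Context {R : realType} {W : finType} (q : W -> R) (n : nat).
Variables (F : W -> R) (x B eta K : R).

(* Chernoff's bound at [lam = n eta / (16 B^2)], which minimises
   [- lam eta + 8 lam^2 B^2 / n]. *)
Lemma tilt_tail :
  is_pmf q -> (0 < n)%N -> 0 < B -> 0 < eta -> 2 * eta <= B ->
  (forall lam, 24 * `|lam| * B <= n%:R ->
    \sum_w q w * tilt lam (8 * lam ^+ 2 / n%:R) (F w) x <=
    K * expR (8 * lam ^+ 2 / n%:R * B ^+ 2)) ->
  \sum_(w | eta < `|F w - x|) q w <=
  2 * K * expR (- (n%:R * eta ^+ 2 / (32 * B ^+ 2))).
Proof.
move=> [q0 _] n0 B0 eta0 etaB mom.
have nR : 0 < n%:R :> R by rewrite ltr0n.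
pose lam : R := n%:R * eta / (16 * B ^+ 2).
have B2 : 0 < 16 * B ^+ 2 by rewrite mulr_gt0 // exprn_gt0.
have lam0 : 0 < lam by rewrite divr_gt0 // mulr_gt0.
have lamB : 24 * `|lam| * B <= n%:R.
  rewrite gtr0_norm // /lam.
  (* Since [2 * eta <= B], the ratio on the right is at most 3/4, so the minimising [lam] is
     admissible. *)
  have -> : 24 * (n%:R * eta / (16 * B ^+ 2)) * B = n%:R * (3 * eta / (2 * B)).
    by field; rewrite gt_eqF.
  by rewrite ler_piMr // ler_pdivrMr ?mulr_gt0 //; lra.
pose beta := 8 * lam ^+ 2 / n%:R.
have beta0 : 0 <= beta by rewrite divr_ge0 // mulr_ge0 // sqr_ge0.
have momP := mom lam lamB.
have momN := mom (- lam); rewrite normrN sqrrN in momN; have {}momN := momN lamB.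
have expE : expR (- (n%:R * eta ^+ 2 / (32 * B ^+ 2))) =
    expR (- (lam * eta)) * expR (beta * B ^+ 2).
  by rewrite -expRD; congr expR; rewrite /beta /lam; field; rewrite !gt_eqF.
rewrite expE.
apply: (@le_trans _ _ (expR (- (lam * eta)) *
  (\sum_w q w * tilt lam beta (F w) x + \sum_w q w * tilt (- lam) beta (F w) x))).
  rewrite -big_split mulr_sumr big_mkcond /=; apply: ler_sum => w _.
  have tp : 0 <= tilt lam beta (F w) x by exact: expR_ge0.
  have tn : 0 <= tilt (- lam) beta (F w) x by exact: expR_ge0.
  case: ifPn => [bad|_]; last first.
    by rewrite mulr_ge0 ?expR_ge0 // addr_ge0 // mulr_ge0.
  rewrite -mulrDr mulrCA ler_peMr //.
  apply: (@le_trans _ _ (expR (- (lam * eta)) * expR (lam * `|F w - x|))).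
    by rewrite -expRD -[leLHS]expR0 ler_expR addrC subr_ge0 ler_wpM2l // ltW.
  rewrite ler_wpM2l ?expR_ge0 //.
  have le_tilt l : expR (l * (F w - x)) <= tilt l beta (F w) x.
    by rewrite ler_expR lerDl mulr_ge0 // sqr_ge0.
  have [d0|d0] := ger0P (F w - x).
    by rewrite (le_trans (le_tilt lam)) // lerDl.
  rewrite mulrN -mulNr.
  by rewrite (le_trans (le_tilt (- lam))) // lerDr.
rewrite [2 * K * _]mulrCA ler_wpM2l ?expR_ge0 //.
by move: momP momN; rewrite -/beta; lra.
Qed.

End Tail.

(** * Conditional value-at-risk as a functional of the mean excess *)

Section ValueAtRisk.
Context {R : realType}.
Variables (B alpha : R).

(* Clipping the total cost to its range [0, B] changes nothing on the histories
   of the process and makes [excess mu] bounded for [mu] in [0, B]. *)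
Definition excess (mu z : R) : R :=
  Num.max (Num.min (Num.max z 0) B - mu) 0.

(** Taken on an arbitrary [F], since the optimal excess, minimised over policies separately at each
    [mu], need not come from one random variable. *)
Definition cvar (F : R -> R) : R :=
  inf [set mu + alpha^-1 * F mu | mu in [set: R]].

(* The properties of [mu |-> E (Z - mu)_+] for [Z] in [0, B]. *)
Definition excess_mean (F : R -> R) : Prop :=
  [/\ forall mu : R, 0 <= mu <= B -> 0 <= F mu,
      forall mu nu : R, F mu <= F nu + `|mu - nu|,
      forall mu : R, mu <= 0 -> F mu = F 0 - mu &
      forall mu : R, B <= mu -> F mu = F B].

Hypothesis B_ge0 : 0 <= B.

Lemma excess_itv (mu z : R) : 0 <= mu <= B -> 0 <= excess mu z <= B.
Proof.
rewrite /excess => /andP[mu0 muB]; rewrite le_max lexx orbT ge_max B_ge0 andbT /=.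
have : Num.min (Num.max z 0) B <= B by rewrite ge_min lexx orbT.
lra.
Qed.

Lemma excess_lip (mu nu z : R) : excess mu z <= excess nu z + `|mu - nu|.
Proof.
rewrite /excess; set y := Num.min _ _.
have h : y - nu <= Num.max (y - nu) 0 by rewrite le_max lexx.
have h' : 0 <= Num.max (y - nu) 0 by rewrite le_max lexx orbT.
have : nu - mu <= `|mu - nu| by rewrite distrC ler_norm.
have := normr_ge0 (mu - nu).
by rewrite ge_max; move: h h'; set m := Num.max _ _ => *; apply/andP; split; lra.
Qed.

Lemma excess_le0 (mu z : R) : mu <= 0 -> excess mu z = excess 0 z - mu.
Proof.
move=> mu0; rewrite /excess subr0; set y := Num.min _ _.
have y0 : 0 <= y by rewrite /y le_min le_max lexx orbT B_ge0.
by rewrite !max_l //; lra.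
Qed.

Lemma excess_geB (mu z : R) : B <= mu -> excess mu z = excess B z.
Proof.
move=> muB; rewrite /excess; set y := Num.min _ _.
have yB : y <= B by rewrite /y ge_min lexx orbT.
by rewrite !max_r //; lra.
Qed.

Lemma excessE (mu z : R) : 0 <= z <= B -> excess mu z = Num.max (z - mu) 0.
Proof. by move=> /andP[z0 zB]; rewrite /excess (max_l z0) (min_l zB). Qed.

Hypothesis alpha_itv : 0 < alpha < 1.

Let ialpha_ge1 : 1 <= alpha^-1.
Proof. by case/andP: alpha_itv => a0 a1; rewrite invf_ge1 // ltW. Qed.

(** For negative [mu], [F mu = F 0 - mu] is nonnegative and [alpha^-1 >= 1], so the expression is at
    least [mu + F mu = F 0]. *)
Lemma cvar_ge0 (F : R -> R) (mu : R) :
  excess_mean F -> 0 <= mu + alpha^-1 * F mu.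
Proof.
move=> [F0 _ Fneg FgeB].
have pos (nu : R) : 0 <= nu -> 0 <= F nu.
  move=> nu0; have [/ltW nuB|Bnu] := ltP nu B; first by rewrite F0 // nu0.
  by rewrite FgeB // F0 // lexx B_ge0.
have [mu0|mu0] := lerP 0 mu.
  by rewrite addr_ge0 // mulr_ge0 ?pos // invr_ge0; case/andP: alpha_itv => /ltW.
have Fmu := Fneg mu (ltW mu0); have := pos 0 (lexx 0) => F00.
have : F mu <= alpha^-1 * F mu by rewrite ler_peMl // Fmu; lra.
by rewrite {1}Fmu; lra.
Qed.

Lemma cvar_set_lbound (F : R -> R) : excess_mean F ->
  has_lbound [set mu + alpha^-1 * F mu | mu in [set: R]].
Proof. by move=> FE; exists 0 => _ [mu _ <-]; exact: cvar_ge0. Qed.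

Lemma cvar_le (F F' : R -> R) (eps : R) : excess_mean F ->
  (forall mu, F mu <= F' mu + alpha * eps) -> cvar F <= cvar F' + eps.
Proof.
move=> FE FF; rewrite -lerBlDr; apply: lb_le_inf.
  by exists (0 + alpha^-1 * F' 0); exists 0.
move=> _ [mu _ <-]; rewrite lerBlDr.
apply: (@le_trans _ _ (mu + alpha^-1 * F mu)).
  by apply: ge_inf; [exact: cvar_set_lbound|exists mu].
have a0 : 0 < alpha by case/andP: alpha_itv.
rewrite -addrA lerD2l.
have -> : alpha^-1 * F' mu + eps = alpha^-1 * (F' mu + alpha * eps).
  by field; rewrite gt_eqF.
by rewrite ler_wpM2l // invr_ge0 ltW.
Qed.

Lemma cvar_close (F F' : R -> R) (eps : R) : excess_mean F -> excess_mean F' ->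
  (forall mu, `|F mu - F' mu| <= alpha * eps) -> `|cvar F - cvar F'| <= eps.
Proof.
move=> FE FE' FF.
have FF1 mu : F mu <= F' mu + alpha * eps.
  by have := FF mu; rewrite ler_norml; lra.
have FF2 mu : F' mu <= F mu + alpha * eps.
  by have := FF mu; rewrite ler_norml; lra.
by have := cvar_le FE FF1; have := cvar_le FE' FF2; rewrite ler_norml; lra.
Qed.

(** The upper bound is the choice [mu = B]. It settles the regime [eps > B]. *)
Lemma cvar_leB (F : R -> R) : excess_mean F -> F B = 0 -> 0 <= cvar F <= B.
Proof.
move=> FE FB; apply/andP; split.
  apply: lb_le_inf; first by exists (0 + alpha^-1 * F 0); exists 0.
  by move=> _ [mu _ <-]; exact: cvar_ge0.
apply: ge_inf; first exact: cvar_set_lbound.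
by exists B => //; rewrite FB mulr0 addr0.
Qed.

(** Outside [[0, B]] the difference [F - F'] is frozen at its endpoint values. Inside, [mu] is
    rounded down to a grid point, at a cost of [h] for each of the two 1-Lipschitz functions. *)
Lemma excess_mean_grid (F F' : R -> R) (eta h : R) (N : nat) :
  excess_mean F -> excess_mean F' -> 0 < h -> B < N%:R * h ->
  (forall j, (j < N)%N -> j%:R * h <= B ->
     `|F (j%:R * h) - F' (j%:R * h)| <= eta) ->
  forall mu, `|F mu - F' mu| <= eta + 2 * h.
Proof.
move=> [_ FL Fneg FgeB] [_ FL' Fneg' FgeB'] h0 NB FF.
have main (mu : R) : 0 <= mu <= B -> `|F mu - F' mu| <= eta + 2 * h.
  move=> /andP[mu0 muB].
  have := @truncn_itv _ (mu / h); rewrite divr_ge0 ?(ltW h0) // => /(_ isT).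
  set j := Num.truncn _; rewrite ler_pdivlMr // ltr_pdivrMr // -natr1 mulrDl mul1r.
  move=> /andP[j1 j2].
  have jN : (j < N)%N.
    by rewrite -(ltr_nat R) -(ltr_pM2r h0) (le_lt_trans j1) // (le_lt_trans muB).
  have := FF j jN (le_trans j1 muB).
  have d : `|mu - j%:R * h| <= h by rewrite ler_norml; lra.
  have d' : `|j%:R * h - mu| <= h by rewrite distrC.
  have near (G : R -> R) (nu nu' : R) : (forall x y, G x <= G y + `|x - y|) ->
      `|nu - nu'| <= h -> G nu <= G nu' + h.
    by move=> GL d''; apply: le_trans (GL nu nu') _; rewrite lerD2l.
  have := near _ _ _ FL d; have := near _ _ _ FL d'.
  have := near _ _ _ FL' d; have := near _ _ _ FL' d'.
  by rewrite !ler_norml; lra.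
move=> mu; have [mu0|mu0] := lerP mu 0.
  rewrite Fneg // Fneg' // opprB addrA subrK; apply: main.
  by rewrite lexx B_ge0.
have [muB|muB] := lerP B mu.
  by rewrite FgeB // FgeB' //; apply: main; rewrite lexx B_ge0.
by apply: main; rewrite !ltW.
Qed.

End ValueAtRisk.

(** * Risks of the process expressed by backward values *)

Section RiskValue.
Context {R : realType} {T : nat} (M : mdp R T).
Variable alpha : R.
Hypothesis alpha_itv : 0 < alpha < 1.

Local Notation B := (T.+1%:R : R).

Let B_ge0 : 0 <= B. Proof. exact: ler0n. Qed.

Definition policy_excess (P : trans_kernel M) (pi : policy M) (s : state M 0)
    (mu : R) : R :=
  policy_value (excess B mu) P pi T (s : hist M 0).

Definition opt_excess (P : trans_kernel M) (s : state M 0) (mu : R) : R :=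
  opt_value (excess B mu) P T s 0.

Lemma policy_excess_mean (P : trans_kernel M) (pi : policy M) (s : state M 0) :
  is_kernel P -> is_policy pi -> excess_mean B (policy_excess P pi s).
Proof.
move=> PK piP; rewrite /policy_excess.
have shift mu nu c : (forall z, excess B mu z <= excess B nu z + c) ->
    policy_value (excess B mu) P pi T (s : hist M 0) <=
    policy_value (excess B nu) P pi T (s : hist M 0) + c.
  by move=> le_c; apply: policy_value_leD.
split=> [mu muB|mu nu|mu mu0|mu muB].
- suff /andP[] : 0 <= policy_value (excess B mu) P pi T (s : hist M 0) <= B by [].
  by apply: policy_value_itv => // z; exact: excess_itv.
- by apply: shift => z; exact: excess_lip.
- apply/eqP; rewrite eq_le; apply/andP; split.
    by apply: shift => z; rewrite excess_le0.
  by rewrite lerBlDr; apply: shift => z; rewrite (excess_le0 _ z mu0) // subrK.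
- apply/eqP; rewrite eq_le -[X in _ <= X]addr0 -[X in _ && (_ <= X)]addr0.
  by rewrite !shift // => z; rewrite addr0 excess_geB.
Qed.

Lemma opt_excess_mean (P : trans_kernel M) (s : state M 0) :
  is_kernel P -> excess_mean B (opt_excess P s).
Proof.
move=> PK; rewrite /opt_excess.
have shift mu nu c : (forall z, excess B mu z <= excess B nu z + c) ->
    opt_value (excess B mu) P T s 0 <= opt_value (excess B nu) P T s 0 + c.
  by move=> le_c; apply: opt_value_leD.
split=> [mu muB|mu nu|mu mu0|mu muB].
- suff /andP[] : 0 <= opt_value (excess B mu) P T s 0 <= B by [].
  by apply: opt_value_itv => // z; exact: excess_itv.
- by apply: shift => z; exact: excess_lip.
- apply/eqP; rewrite eq_le; apply/andP; split.
    by apply: shift => z; rewrite excess_le0.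
  by rewrite lerBlDr; apply: shift => z; rewrite (excess_le0 _ z mu0) // subrK.
- apply/eqP; rewrite eq_le -[X in _ <= X]addr0 -[X in _ && (_ <= X)]addr0.
  by rewrite !shift // => z; rewrite addr0 excess_geB.
Qed.

Let excessBB_itv z : 0 <= excess B B z <= 0.
Proof.
rewrite /excess max_r ?lexx //.
by have : Num.min (Num.max z 0) B <= B by [rewrite ge_min lexx orbT]; lra.
Qed.

Lemma policy_excessB (P : trans_kernel M) (pi : policy M) (s : state M 0) :
  is_kernel P -> is_policy pi -> policy_excess P pi s B = 0.
Proof.
move=> PK piP; apply/eqP; rewrite eq_le andbC.
by apply: policy_value_itv.
Qed.

Lemma opt_excessB (P : trans_kernel M) (s : state M 0) :
  is_kernel P -> opt_excess P s B = 0.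
Proof.
move=> PK; apply/eqP; rewrite eq_le andbC.
by apply: opt_value_itv.
Qed.

Lemma risk_cvar (P : trans_kernel M) (pi : policy M) (s : state M 0) :
  risk alpha P pi s = cvar alpha (policy_excess P pi s).
Proof.
rewrite /risk /cvar; congr (inf (image _ _)); apply/funext => mu.
rewrite /policy_excess -expect_policy_value /expect.
congr (_ + _ * _); apply: eq_bigr => h _; apply: eq_bigr => a _.
by rewrite excessE // total_cost_itv.
Qed.

(** The minima over policies and over [mu] are exchanged: for each fixed [mu], the greedy policy of
    that [mu] attains [opt_excess]. *)
Lemma opt_risk_cvar (P : trans_kernel M) (s : state M 0) :
  is_kernel P -> opt_risk alpha P s = cvar alpha (opt_excess P s).
Proof.
move=> PK; apply/eqP; rewrite eq_le; apply/andP; split.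
- apply: lb_le_inf; first by exists (0 + alpha^-1 * opt_excess P s 0); exists 0.
  move=> _ [mu _ <-]; pose pi := greedy_policy (excess B mu) P.
  have piP : is_policy pi by exact: greedy_policyP.
  apply: (@le_trans _ _ (risk alpha P pi s)).
    apply: ge_inf; last by exists pi.
    exists 0 => _ [pi' pi'P <-]; rewrite risk_cvar.
    have [] := andP (cvar_leB B_ge0 alpha_itv (policy_excess_mean s PK pi'P)
                       (policy_excessB s PK pi'P)) => //.
  rewrite risk_cvar; apply: ge_inf.
    exact: (cvar_set_lbound B_ge0 alpha_itv (policy_excess_mean s PK piP)).
  by exists mu => //; rewrite /policy_excess greedy_policy_value.
- apply: lb_le_inf.
    exists (risk alpha P (greedy_policy (excess B 0) P) s).
    by exists (greedy_policy (excess B 0) P) => //; exact: greedy_policyP.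
  move=> _ [pi piP <-]; rewrite risk_cvar -[leRHS]addr0.
  apply: (cvar_le B_ge0 alpha_itv (opt_excess_mean s PK)) => mu.
  rewrite mulr0 addr0 /opt_excess /policy_excess.
  exact: (opt_value_le _ (s : hist M 0) PK piP).
Qed.

Lemma policy_of_augP (pi : aug_policy M) :
  is_aug_policy pi -> is_policy (policy_of_aug pi).
Proof. by move=> piP t h tT; apply: piP => //; exact: hist_cost_itv. Qed.

End RiskValue.

(** * Transfer from the probability space to the finite sample table *)

Section FiniteRandomVector.
Context {R : realType} {d : measure_display} {Omega : measurableType d}.
Variable Pr : probability Omega R.
Context {I : finType} {V : I -> finType}.
Variables (p : forall i, V i -> R) (X : forall i, Omega -> V i).
Hypothesis X_measurable : forall i v, measurable (X i @^-1` [set v]).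
Hypothesis X_law : forall i v, Pr (X i @^-1` [set v]) = (p v)%:E.
Hypothesis X_indep : mutually_independent Pr X.

Local Notation W := {dffun forall i, V i}.

Definition random_vector (w : Omega) : W := finfun (fun i => X i w).

Lemma random_vector_fiber (x : W) :
  random_vector @^-1` [set x] =
  \bigcap_(i in [set` [set: I]%SET]) (X i @^-1` [set x i]).
Proof.
apply/seteqP; split=> w /=; first by move=> <- i _ /=; rewrite ffunE.
by move=> wx; apply/ffunP => i; rewrite ffunE; apply: wx; rewrite /= inE.
Qed.

Lemma random_vector_measurable (x : W) :
  measurable (random_vector @^-1` [set x]).
Proof.
rewrite random_vector_fiber; exact: fin_bigcap_measurable.
Qed.

Lemma random_vector_law (x : W) :
  Pr (random_vector @^-1` [set x]) = (product_weight p x)%:E.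
Proof.
rewrite random_vector_fiber X_indep /product_weight -prodEFin.
by apply: eq_big => [i|i _]; [rewrite inE|exact: X_law].
Qed.

Lemma random_vector_event (E : {set W}) :
  measurable [set w | random_vector w \in E] /\
  Pr [set w | random_vector w \in E] = (\sum_(x in E) product_weight p x)%:E.
Proof.
have -> : [set w | random_vector w \in E] =
    \bigcup_(x in [set` E]) (random_vector @^-1` [set x]).
  apply/seteqP; split=> [w /= wE|w [x xE wx]]; first by exists (random_vector w).
  by rewrite /= in wx xE *; rewrite wx.
split.
  apply: fin_bigcup_measurable => // x _; exact: random_vector_measurable.
rewrite measure_fin_bigcup //.
- rewrite (fsbigE (enum E)) ?enum_uniq //; last 2 first.
  + by move=> x; rewrite /= mem_enum.
  + by move=> x /= xE; rewrite mem_enum xE.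
  rewrite -sumEFin big_enum_cond /=.
  by apply: eq_big => [x|x _]; [rewrite mem_setE andbb|exact: random_vector_law].
- by move=> x y _ _ [w [/= <- <-]].
- by move=> x _; exact: random_vector_measurable.
Qed.

End FiniteRandomVector.

(** * Union bound over initial states and the grid *)

Section SamplingBound.
Context {R : realType} {T : nat} {M : mdp R T} {n : nat}.
Context {d : measure_display} {Omega : measurableType d}.
Variables (Pr : probability Omega R) (Y : sampler Omega M n).
Hypothesis YP : is_generative_sampler Pr Y.

Local Notation B := (T.+1%:R : R).
Local Notation W := {dffun forall k : sample_index M n, state M (tag k).+1}.
Local Notation weight := (product_weight (@sample_law R T M n)).

Let X (k : sample_index M n) : Omega -> state M (tag k).+1 :=
  Y (tagged k).1.1 (tagged k).1.2 (tagged k).2.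

Let X_measurable (k : sample_index M n) (v : state M (tag k).+1) :
  measurable (X k @^-1` [set v]).
Proof. by case: YP => Ym _ _; exact: Ym. Qed.

Let X_law (k : sample_index M n) (v : state M (tag k).+1) :
  Pr (X k @^-1` [set v]) = (sample_law v)%:E.
Proof. by case: YP => _ Yl _; exact: Yl. Qed.

Let X_event (E : {set W}) :
  measurable [set w | random_vector X w \in E] /\
  Pr [set w | random_vector X w \in E] = (\sum_(x in E) weight x)%:E.
Proof. by case: YP => _ _ Yi; exact: random_vector_event. Qed.

(** Read off from the total mass of [Pr], with no expansion of a product of sums. *)
Lemma sample_weight_total : \sum_x weight x = 1.
Proof.
have [_] := X_event [set: W]%SET.
have -> : [set w | random_vector X w \in [set: W]%SET] = setT.
  by apply/seteqP; split=> // w _ /=; rewrite inE.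
rewrite probability_setT => -[->].
by apply: eq_bigl => x; rewrite inE.
Qed.

Lemma empirical_kernelE w t (s : state M t) a s' : (t < T)%N ->
  empirical_kernel Y w s a s' = table_kernel (random_vector X w) s a s'.
Proof.
move=> tT; rewrite (table_kernelE _ tT) /empirical_kernel.
by congr (_%:R / _); apply: eq_card => i; rewrite !inE ffunE.
Qed.

Lemma empirical_is_kernel w : (0 < n)%N -> is_kernel (empirical_kernel Y w).
Proof.
move=> n0 t s a tT.
have -> : empirical_kernel Y w s a = table_kernel (random_vector X w) s a.
  by apply/funext => s'; exact: empirical_kernelE.
exact: table_kernel_is_kernel.
Qed.

Variable val : trans_kernel M -> state M 0 -> R -> R.
Variables (alpha eps delta K : R) (N : nat).
Hypothesis val_excess_mean : forall P s, is_kernel P -> excess_mean B (val P s).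
Hypothesis valB : forall P s, is_kernel P -> val P s B = 0.
Hypothesis eq_val : forall P P' s,
  (forall t (r : state M t) a r', (t < T)%N -> P t r a r' = P' t r a r') ->
  val P s = val P' s.

Hypothesis val_exp_moment : forall s (mu lam : R), eps <= B -> 0 <= mu <= B ->
  24 * `|lam| * B <= n%:R ->
  \sum_x weight x * tilt lam (8 * lam ^+ 2 / n%:R) (val (table_kernel x) s mu)
                      (val (@trans R T M) s mu) <=
  K * expR (8 * lam ^+ 2 / n%:R * B ^+ 2).
Hypothesis alpha_itv : 0 < alpha < 1.
Hypothesis eps_gt0 : 0 < eps.
Hypothesis n_gt0 : (0 < n)%N.
Hypothesis delta_ge0 : 0 <= delta.

Let good_event : [set w | forall s : state M 0,
    `|cvar alpha (val (empirical_kernel Y w) s) -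
      cvar alpha (val (@trans R T M) s)| <= eps]
  = [set w | random_vector X w \in [set x | `[< forall s : state M 0,
    `|cvar alpha (val (table_kernel x) s) -
      cvar alpha (val (@trans R T M) s)| <= eps >]]%SET].
Proof.
apply/seteqP; split=> w /=; rewrite inE.
  move=> ws; apply/asboolP => s; rewrite -(eq_val (P := empirical_kernel Y w)) //.
  by move=> t r a r' tT; rewrite empirical_kernelE.
move=> /asboolP ws s; rewrite (eq_val (P' := table_kernel (random_vector X w))) //.
by move=> t r a r' tT; rewrite empirical_kernelE.
Qed.

(** [val] stands for [policy_excess] or [opt_excess]; the two parts of the theorem differ here only
    by [K], which is [1] or [|A|^T]. *)
Lemma cvar_sampling_bound :
  (eps <= B -> B < N%:R * (alpha * eps / 4)) ->
  (eps <= B -> N%:R * #|state M 0|%:R *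
    (2 * K * expR (- (n%:R * (alpha * eps / 2) ^+ 2 / (32 * B ^+ 2)))) <= delta) ->
  ((1 - delta)%:E <= Pr [set w | (forall s : state M 0,
     `|cvar alpha (val (empirical_kernel Y w) s) -
       cvar alpha (val (@trans R T M) s)| <= eps)%R])%E.
Proof.
move=> NB Ndelta; rewrite good_event.
set G := [set x | _]%SET.
have [_ ->] := X_event G; rewrite lee_fin.
have B0 : 0 <= B by exact: ler0n.
have a0 : 0 < alpha by case/andP: alpha_itv.
have TM s := val_excess_mean s (@trans_is_kernel R T M).
have TK (x : W) : is_kernel (table_kernel x : trans_kernel M).
  exact: table_kernel_is_kernel.
have TKM x s := val_excess_mean s (TK x).
have weight_pmf : is_pmf weight.
  split; last exact: sample_weight_total.
  by move=> x; apply: product_weight_ge0; exact: sample_law_pmf.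
rewrite -sample_weight_total (bigID (mem G)) /= -addrA gerDl subr_le0.
have [epsB|Beps] := lerP eps B; last first.
  rewrite big1 // => x /negP[]; rewrite inE; apply/asboolP => s.
  have := cvar_leB B0 alpha_itv (TM s) (valB s (@trans_is_kernel R T M)).
  have := cvar_leB B0 alpha_itv (TKM x s) (valB s (TK x)).
  by rewrite ler_norml; lra.
apply: le_trans (Ndelta epsB).
(* The tolerance [alpha * eps] is halved: [eta] for deviations at grid points, [2 * h] for
   rounding. *)
set h := alpha * eps / 4; set eta := alpha * eps / 2.
pose bad (s : state M 0) (j : 'I_N) (x : W) := (j%:R * h <= B) &&
  (eta < `|val (table_kernel x) s (j%:R * h) - val (@trans R T M) s (j%:R * h)|).
have h0 : 0 < h by rewrite divr_gt0 // mulr_gt0.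
have cover x : x \notin G -> exists s, exists j, bad s j x.
  apply: contraNP => nbad; rewrite inE; apply/asboolP => s.
  apply: (cvar_close B0 alpha_itv (TKM x s) (TM s)).
  have -> : alpha * eps = eta + 2 * h by rewrite /eta /h; field.
  apply: (excess_mean_grid B0 (TKM x s) (TM s) h0 (NB epsB)) => j jN jB.
  rewrite leNgt; apply/negP => etaj; apply: nbad.
  by exists s, (Ordinal jN); rewrite /bad jB.
apply: (@le_trans _ _ (\sum_(s : state M 0) \sum_(j < N) \sum_(x | bad s j x) weight x)).
  under [leRHS]eq_bigr do under eq_bigr do rewrite big_mkcond.
  under [leRHS]eq_bigr do rewrite exchange_big.
  rewrite exchange_big big_mkcond /=; apply: ler_sum => x _.
  have w0 : 0 <= weight x by exact: (proj1 weight_pmf).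
  have t0 s j : 0 <= (if bad s j x then weight x else 0) by case: ifP.
  case: ifPn => [/cover[s [j bsj]]|_]; last first.
    by apply: sumr_ge0 => s _; exact: sumr_ge0.
  rewrite (bigD1 s) //= (bigD1 j) //= bsj -addrA lerDl addr_ge0 //.
    exact: sumr_ge0.
  by apply: sumr_ge0 => s' _; exact: sumr_ge0.
set q := 2 * K * _.
apply: (@le_trans _ _ (\sum_(s : state M 0) \sum_(j < N) q)); last first.
  rewrite !sumr_const card_ord -(mulr_natr (q *+ N)) -(mulr_natr q).
  by rewrite [q * _]mulrC mulrAC.
(* The moment bound at [lam = 0] forces [K >= 0]. *)
have q0 (s : state M 0) : 0 <= q.
  have := @val_exp_moment s 0 0 epsB; rewrite normr0 mulr0 mul0r lexx B0 => /(_ isT).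
  rewrite ler0n => /(_ isT).
  rewrite !(expr0n, mulr0, mul0r) /= expR0 mulr1 => K0.
  rewrite /q mulr_ge0 ?expR_ge0 // mulr_ge0 // (le_trans _ K0) //.
  by apply: mean_ge0 => // x; exact: expR_ge0.
apply: ler_sum => s _; apply: ler_sum => j _; rewrite /bad.
have [jB|_] := lerP (j%:R * h) B; last by rewrite big_pred0 // q0.
have jhB : 0 <= j%:R * h <= B by rewrite jB mulr_ge0 // ltW.
apply: (tilt_tail (F := fun x => val (table_kernel x) s (j%:R * h))) => //.
- by rewrite divr_gt0 // mulr_gt0.
- have -> : 2 * eta = alpha * eps by rewrite /eta; field.
  apply: le_trans epsB; rewrite ler_piMl ?(ltW eps_gt0) //.
  by case/andP: alpha_itv => _ /ltW.
- by move=> lam lamB; exact: val_exp_moment.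
Qed.

End SamplingBound.

(** * Numerical constants of the sample size *)

Section SampleSize.
Context {R : realType}.
Variables (T n : nat) (alpha eps : R).
Hypothesis T_gt0 : (0 < T)%N.
Hypothesis alpha_itv : 0 < alpha < 1.
Hypothesis eps_gt0 : 0 < eps.

Local Notation B := (T.+1%:R : R).

Let alpha_gt0 : 0 < alpha. Proof. by case/andP: alpha_itv. Qed.

Let T_ge1 : 1 <= T%:R :> R. Proof. by rewrite ler1n. Qed.

Let B_le : B <= 2 * T%:R.
Proof. by rewrite -natr1 [_ * _]mulr_natl mulr2n lerD2l. Qed.

(** Here [B <= 2 T] gives [32 B^2 <= 128 T^2], while [(alpha eps / 2)^2] turns 4096 into [1024 T^2]:
    the quotient is the 8. *)
Lemma sample_size_exponent (L : R) : 2^-1 <= L ->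
  4096 * (T%:R ^+ 2 / (alpha ^+ 2 * eps ^+ 2)) * L <= n%:R ->
  8 * L <= n%:R * (alpha * eps / 2) ^+ 2 / (32 * B ^+ 2).
Proof.
move=> L2 nL; have L0 : 0 <= L by lra.
rewrite ler_pdivlMr ?mulr_gt0 ?exprn_gt0 //.
apply: (@le_trans _ _ (4096 * (T%:R ^+ 2 / (alpha ^+ 2 * eps ^+ 2)) * L *
                       (alpha * eps / 2) ^+ 2)); last first.
  by rewrite ler_wpM2r ?sqr_ge0.
have -> : 4096 * (T%:R ^+ 2 / (alpha ^+ 2 * eps ^+ 2)) * L * (alpha * eps / 2) ^+ 2
   = 8 * L * (32 * (2 * T%:R) ^+ 2).
  by field; rewrite !gt_eqF.
by rewrite ler_wpM2l ?mulr_ge0 // ler_wpM2l // ler_sqr ?nnegrE // mulr_ge0.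
Qed.

Lemma sample_size_ge8 (L : R) : eps <= B -> 2^-1 <= L ->
  4096 * (T%:R ^+ 2 / (alpha ^+ 2 * eps ^+ 2)) * L <= n%:R -> (8 <= n)%N.
Proof.
move=> epsB L2 nL; rewrite -(ler_nat R); apply: le_trans nL.
have q4 : 4^-1 <= T%:R ^+ 2 / (alpha ^+ 2 * eps ^+ 2).
  rewrite ler_pdivlMr ?mulr_gt0 ?exprn_gt0 // mulrC ler_pdivrMr // -exprMn.
  have -> : T%:R ^+ 2 * 4 = (2 * T%:R) ^+ 2 :> R by ring.
  rewrite ler_sqr ?nnegrE ?mulr_ge0 ?(ltW alpha_gt0) ?(ltW eps_gt0) //.
  rewrite (le_trans _ B_le) // (le_trans _ epsB) // ler_piMl ?(ltW eps_gt0) //.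
  by case/andP: alpha_itv => _ /ltW.
have : 4^-1 * 2^-1 <= T%:R ^+ 2 / (alpha ^+ 2 * eps ^+ 2) * L.
  by rewrite ler_pM.
by rewrite -[4096 * _ * L]mulrA; set x := _ * L; lra.
Qed.

Definition grid_size : nat := (Num.truncn (4 * B / (alpha * eps))).+1.

Lemma grid_size_gt : B < grid_size%:R * (alpha * eps / 4).
Proof.
have ae0 : 0 < alpha * eps by rewrite mulr_gt0.
have := truncnS_gt (4 * B / (alpha * eps)).
rewrite -/grid_size ltr_pdivrMr // => h; lra.
Qed.

(** Twice the number of pairs of a state and a grid point is at most [18 delta X], where [X] is the
    base of the sixth power. As [X >= 2], [18 <= X^5], whence the exponent 6. *)
Lemma union_bound_budget (S0 S : nat) (delta K e : R) :
  eps <= B -> 0 < delta < 1 -> (S0 <= S)%N -> (0 < S)%N -> 0 <= K ->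
  K * (T%:R * S%:R * Num.max eps^-1 2 / (delta * alpha)) ^+ 6 <= expR e ->
  grid_size%:R * S0%:R * (2 * K * expR (- e)) <= delta.
Proof.
move=> epsB /andP[d0 d1] S0S S1 K0; set m := Num.max _ _; set X := _ / _ => KX.
have m2 : 2 <= m by rewrite le_max lexx orbT.
have me : eps^-1 <= m by rewrite le_max lexx.
have SR : 1 <= S%:R :> R by rewrite ler1n.
have TSm : 2 <= T%:R * S%:R * m.
  rewrite -[leLHS]mul1r ler_pM // -[leLHS]mul1r ler_pM //.
have X2 : 2 <= X.
  rewrite /X ler_pdivlMr ?mulr_gt0 //; apply: le_trans TSm.
  rewrite ler_piMr // mulr_ile1 // ?ltW //; by case/andP: alpha_itv.
have Ng : grid_size%:R <= 9 * (T%:R * m / alpha).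
  have : (Num.truncn (4 * B / (alpha * eps)))%:R <= 4 * B / (alpha * eps).
    by rewrite truncn_le // divr_ge0 // ?mulr_ge0 // ltW.
  have : 4 * B / (alpha * eps) <= 8 * (T%:R * m / alpha).
    have -> : 4 * B / (alpha * eps) = 4 * B * eps^-1 / alpha.
      by field; rewrite !gt_eqF.
    have -> : 8 * (T%:R * m / alpha) = 4 * (2 * T%:R) * m / alpha.
      by field; rewrite gt_eqF.
    rewrite ler_wpM2r ?invr_ge0 ?(ltW alpha_gt0) // ler_pM ?invr_ge0 ?(ltW eps_gt0) //.
    by rewrite ler_wpM2l.
  have : 1 <= T%:R * m / alpha.
    rewrite ler_pdivlMr // mul1r; have := alpha_itv => /andP[_ /ltW a1].
    by rewrite (le_trans a1) // -[leLHS]mulr1 ler_pM //; lra.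
  by rewrite /grid_size -natr1; lra.
have X5 : 18 <= X ^+ 5.
  apply: (@le_trans _ _ (2 ^+ 5)); first by rewrite -natrX ler_nat.
  by rewrite lerXn2r ?nnegrE //; lra.
have NS : grid_size%:R * S0%:R * 2 <= delta * X ^+ 6.
  apply: (@le_trans _ _ (9 * (T%:R * m / alpha) * S%:R * 2)).
    by rewrite ler_wpM2r // ler_pM // ler_nat.
  have -> : 9 * (T%:R * m / alpha) * S%:R * 2 = delta * (X * 18).
    by rewrite /X; field; rewrite !gt_eqF.
  rewrite ler_wpM2l ?(ltW d0) // exprS ler_wpM2l //; lra.
rewrite expRN mulrA ler_pdivrMr ?expR_gt0 // mulrA.
apply: (@le_trans _ _ (delta * X ^+ 6 * K)); first by rewrite ler_wpM2r.
by rewrite -mulrA ler_wpM2l ?(ltW d0) // mulrC.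
Qed.

End SampleSize.

(** * Assembly of the two bounds *)

Lemma ln_ge_half (R : realType) (x : R) : 2 <= x -> 2^-1 <= ln x.
Proof.
move=> x2; rewrite -ler_expR lnK ?posrE; last by lra.
apply: le_trans x2; rewrite -[expR _]invrK -expRN -[leRHS]invrK.
rewrite lef_pV2 ?posrE ?expR_gt0 ?invr_gt0 //.
by apply: le_trans (expR_ge1Dx _); lra.
Qed.

Theorem corollary4p1 (R : realType) :
  exists C : R, 0 < C /\
  forall (T : nat) (M : mdp R T) (alpha eps delta : R),
    (0 < T)%N -> 0 < alpha < 1 -> 0 < eps -> 0 < delta < 1 ->
    (forall (pi : aug_policy M) (Lpi : R) (n : nat)
        (d : measure_display) (Omega : measurableType d)
        (Pr : probability Omega R) (Y : sampler Omega M n),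
      is_aug_policy pi -> 0 < Lpi -> aug_lipschitz Lpi pi ->
      n%:Z = Num.ceil (C * (T%:R ^+ 2 / (alpha ^+ 2 * eps ^+ 2)) *
               ln (T%:R * (max_states M)%:R * Num.max Lpi 2
                   * Num.max eps^-1 2 / (delta * alpha))) ->
      is_generative_sampler Pr Y ->
      ((1 - delta)%:E <=
       Pr [set w | (forall s : state M 0,
             `|risk alpha (empirical_kernel Y w) (policy_of_aug pi) s
               - risk alpha (@trans R T M) (policy_of_aug pi) s| <= eps)%R])%E) /\
    (forall (n : nat)
        (d : measure_display) (Omega : measurableType d)
        (Pr : probability Omega R) (Y : sampler Omega M n),
      n%:Z = Num.ceil (C * (T%:R ^+ 3 / (alpha ^+ 2 * eps ^+ 2)) *
               ln (T%:R * (max_states M)%:R * (max_actions M)%:R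
                   * Num.max eps^-1 2 / (delta * alpha))) ->
      is_generative_sampler Pr Y ->
      ((1 - delta)%:E <=
       Pr [set w | (forall s : state M 0,
             `|opt_risk alpha (empirical_kernel Y w) s
               - opt_risk alpha (@trans R T M) s| <= eps)%R])%E).
Proof.
exists 4096; split; first by rewrite ltr0n.
move=> T M alpha eps delta T0 al eps0 de.
have [a0 a1] := andP al; have [d0 d1] := andP de.
have da0 : 0 < delta * alpha by rewrite mulr_gt0.
have da1 : delta * alpha <= 1 by rewrite mulr_ile1 // ltW.
have TR : 1 <= T%:R :> R by rewrite ler1n.
(* Without initial states the event is the whole space; otherwise [max_states M >= 1], which keeps
   the logarithms bounded below. *)
have [S0|S0] := posnP #|state M 0|.
  have no_state (s : state M 0) : False by have := fintype0 s; exact.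
  have trivial_event d (Omega : measurableType d) (Pr : probability Omega R)
      (F : Omega -> state M 0 -> Prop) :
      ((1 - delta)%:E <= Pr [set w | forall s, F w s])%E.
    have -> : [set w | forall s, F w s] = setT.
      by apply/seteqP; split=> // w _ s; have := no_state s.
    by rewrite probability_setT lee_fin lerBlDr lerDl ltW.
  by split=> *; exact: trivial_event.
have SM : (#|state M 0| <= max_states M)%N.
  exact: (leq_bigmax (F := fun i : 'I_T.+1 => #|state M i|) ord0).
have S1 : (0 < max_states M)%N by exact: leq_trans SM.
have SR : 1 <= (max_states M)%:R :> R by rewrite ler1n.
(* The common part of the two logarithm arguments; each is [X] times a factor at least 1. *)
set X := T%:R * (max_states M)%:R * Num.max eps^-1 2 / (delta * alpha).
have X2 : 2 <= X.
  have m2 : 2 <= Num.max eps^-1 2 by rewrite le_max lexx orbT.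
  rewrite /X ler_pdivlMr //; apply: (@le_trans _ _ 2); first by rewrite ler_piMr.
  by rewrite -[leLHS]mul1r ler_pM // -[leLHS]mul1r ler_pM.
have X0 : 0 <= X by apply: le_trans X2.
have T2ae : 0 < T%:R ^+ 2 / (alpha ^+ 2 * eps ^+ 2) :> R.
  by rewrite divr_gt0 ?mulr_gt0 ?exprn_gt0 ?ltr0n.
have n_gt0 n L : 2^-1 <= L ->
    4096 * (T%:R ^+ 2 / (alpha ^+ 2 * eps ^+ 2)) * L <= n%:R :> R -> (0 < n)%N.
  move=> L2 nL; rewrite -(ltr0n R); apply: lt_le_trans nL.
  apply: mulr_gt0; last by lra.
  by apply: mulr_gt0 T2ae; rewrite ltr0n.
split.
- move=> pi Lpi n d Omega Pr Y piP Lpi0 _ nE YP.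
  have {}piP := policy_of_augP piP.
  set Z := T%:R * _ * Num.max Lpi 2 * _ / _ in nE.
  have ZE : Z = X * Num.max Lpi 2 by rewrite /Z /X; field; rewrite !gt_eqF.
  have XZ : X <= Z by rewrite ZE ler_peMr // le_max ler1n orbT.
  have Z2 : 2 <= Z by exact: le_trans XZ.
  have Z1 : 1 <= Z by apply: le_trans Z2; rewrite ler1n.
  have Z0 : 0 < Z by exact: lt_le_trans Z1.
  have nL : 4096 * (T%:R ^+ 2 / (alpha ^+ 2 * eps ^+ 2)) * ln Z <= n%:R.
    by have := ceil_ge (4096 * (T%:R ^+ 2 / (alpha ^+ 2 * eps ^+ 2)) * ln Z); rewrite -nE.
  have L2 : 2^-1 <= ln Z by exact: ln_ge_half.
  have n0 := n_gt0 _ _ L2 nL.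
  under eq_set do under eq_forall do rewrite !risk_cvar.
  apply: (cvar_sampling_bound YP
    (val := fun P s => policy_excess P (policy_of_aug pi) s) (K := 1)
    (N := grid_size T alpha eps)) => //.
  + by move=> P s PK; exact: policy_excess_mean.
  + by move=> P s PK; exact: policy_excessB.
  + move=> P P' s PP'; apply/funext => mu; apply: eq_policy_value => u r a r' uT.
    by apply: PP'.
  + move=> s mu lam epsB muB lamB; rewrite mul1r.
    apply: policy_value_exp_moment => //.
    * exact: sample_size_ge8 L2 nL.
    * exact: sample_weight_total YP.
    * by move=> z; exact: excess_itv.
  + exact: ltW.
  + by move=> _; exact: grid_size_gt.
  + move=> epsB; apply: (union_bound_budget T0 al eps0 (S := max_states M)) => //.
    rewrite mul1r -/X.
    apply: (@le_trans _ _ (expR (8 * ln Z))); last first.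
      by rewrite ler_expR; exact: sample_size_exponent.
    rewrite expRM_natl lnK ?posrE //.
    apply: (@le_trans _ _ (Z ^+ 6)); first by rewrite lerXn2r ?nnegrE // ltW.
    by rewrite ler_weXn2l.
- move=> n d Omega Pr Y nE YP.
  set Z := T%:R * _ * (max_actions M)%:R * _ / _ in nE.
  have A1 : 1 <= (max_actions M)%:R :> R.
    rewrite ler1n (leq_trans (action_gt0 M (leq0n T))) //.
    exact: (leq_bigmax (F := fun i : 'I_T.+1 => #|action M i|) ord0).
  have ZE : Z = X * (max_actions M)%:R by rewrite /Z /X; field; rewrite !gt_eqF.
  have XZ : X <= Z by rewrite ZE ler_peMr.
  have Z2 : 2 <= Z by exact: le_trans XZ.
  have Z1 : 1 <= Z by apply: le_trans Z2; rewrite ler1n.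
  have Z0 : 0 < Z by exact: lt_le_trans Z1.
  have AZ : (max_actions M)%:R <= Z.
    by rewrite ZE ler_peMl // (le_trans _ X2) // ler1n.
  (* The third factor [T] is moved into [L = T * ln Z], so both parts use the same exponent
     lemma. *)
  have nL : 4096 * (T%:R ^+ 2 / (alpha ^+ 2 * eps ^+ 2)) * (T%:R * ln Z) <= n%:R.
    have := ceil_ge (4096 * (T%:R ^+ 3 / (alpha ^+ 2 * eps ^+ 2)) * ln Z).
    rewrite -nE; apply: le_trans; rewrite le_eqVlt; apply/orP; left; apply/eqP.
    by field; rewrite !gt_eqF.
  have L2 : 2^-1 <= T%:R * ln Z.
    rewrite -[leLHS]mul1r ler_pM //; exact: ln_ge_half.
  have n0 := n_gt0 _ _ L2 nL.
  have -> : [set w | forall s : state M 0, `|opt_risk alpha (empirical_kernel Y w) s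
               - opt_risk alpha (@trans R T M) s| <= eps] =
            [set w | forall s : state M 0,
               `|cvar alpha (opt_excess (empirical_kernel Y w) s)
                 - cvar alpha (opt_excess (@trans R T M) s)| <= eps].
    apply: eq_set => w; apply: eq_forall => s.
    rewrite !opt_risk_cvar //; first exact: trans_is_kernel.
    exact: empirical_is_kernel.
  apply: (cvar_sampling_bound YP
    (val := @opt_excess R T M)
    (K := (max_actions M)%:R ^+ T) (N := grid_size T alpha eps)) => //.
  + by move=> P s PK; exact: opt_excess_mean.
  + by move=> P s PK; exact: opt_excessB.
  + move=> P P' s PP'; apply/funext => mu; apply: eq_opt_value => u r a r' uT.
    by apply: PP'.
  + move=> s mu lam epsB muB lamB.
    apply: opt_value_exp_moment => //.
    * exact: sample_size_ge8 L2 nL.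
    * exact: sample_weight_total YP.
    * by move=> z; exact: excess_itv.
  + exact: ltW.
  + by move=> _; exact: grid_size_gt.
  + move=> epsB; apply: (union_bound_budget T0 al eps0 (S := max_states M)) => //.
    rewrite -/X.
    apply: (@le_trans _ _ (expR (8 * (T%:R * ln Z)))); last first.
      by rewrite ler_expR; exact: sample_size_exponent.
    have -> : 8 * (T%:R * ln Z) = (8 * T)%:R * ln Z by rewrite natrM mulrA.
    rewrite expRM_natl lnK ?posrE //.
    (* [Z^T] pays for [|A|^T] and [Z^6] for the union bound; [T + 6 <= 8 T] because [T >= 1]. *)
    apply: (@le_trans _ _ (Z ^+ T * Z ^+ 6)).
      by rewrite ler_pM ?exprn_ge0 ?lerXn2r ?nnegrE // ltW.
    rewrite -exprD ler_weXn2l //.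
    by rewrite mulSn leq_add2l (leq_trans _ (leq_pmulr 7 T0)).
Qed.
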